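(* Let $w=(w_1,\dots,w_n)$ be an $n$-tuple of positive integers and let $d$ be a positive integer with $d\ge 2w_i$ for $i=1,\dots,n$. Let $f\colon(\mathbb{C}^n,0)\to(\mathbb{C},0)$ be a weighted homogeneous polynomial of type $(d;w)$ defining an isolated singularity at the origin $0\in\mathbb{C}^n$. Then $$L(f)=\max_{1\le i\le n}\left(\frac{d}{w_i}-1\right).$$
   Context: A polynomial $f\in\mathbb{C}[z_1,\dots,z_n]$ is weighted homogeneous of type $(d;w)$ (of degree $d$ with respect to the weights $w$) if it is a sum of (constant multiples of) monomials $z_1^{\alpha_1}\cdots z_n^{\alpha_n}$ with $\alpha_1w_1+\dots+\alpha_nw_n=d$. That $f$ defines an isolated singularity at $0$ means that $0$ is an isolated critical point of $f$. For a holomorphic germ $f\colon(\mathbb{C}^n,0)\to(\mathbb{C},0)$ with an isolated critical point at $0$, the Łojasiewicz exponent is $$L(f)=\inf\{\lambda>0 : \text{there are } C>0 \text{ and a neighbourhood } U \text{ of } 0 \text{ with } |\operatorname{grad} f(z)|\ge C|z|^{\lambda}\text{ for all } z\in U\},$$ where $\operatorname{grad} f=(\partial f/\partial z_1,\dots,\partial f/\partial z_n)$. *)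

(* Defs.v *)
From HB Require Import structures.
From mathcomp Require Import all_boot all_order all_algebra.
From mathcomp Require Import complex.
(* mpoly must precede the MathComp-Analysis files: their notations clash in the
   other order. *)
From mathcomp Require Import mpoly.
From mathcomp Require Import boolp classical_sets reals ereal exp.
From mathcomp Require Import topology normedtype derive.

Set Implicit Arguments.
Unset Strict Implicit.
Unset Printing Implicit Defensive.

Import Order.TTheory GRing.Theory Num.Theory.
Import numFieldNormedType.Exports.

Local Open Scope classical_set_scope.
Local Open Scope ring_scope.

Definition wdeg (n : nat) (w : n.-tuple nat) (m : 'X_{1..n}) : nat :=
  (\sum_(i < n) m i * tnth w i)%N.

Lemma wdeg0 (n : nat) (w : n.-tuple nat) : wdeg w 0%MM = 0%N.
Proof. by rewrite /wdeg big1 // => i _; rewrite mnm0E. Qed.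

Lemma wdegD (n : nat) (w : n.-tuple nat) :
  {morph wdeg w : m1 m2 / (m1 + m2)%MM >-> (m1 + m2)%N}.
Proof.
by move=> m1 m2; rewrite /wdeg -big_split /=; apply: eq_bigr => i _;
  rewrite mnmDE mulnDl.
Qed.

(* Makes [f \is d.-homog for wdeg w] available: every monomial occurring in [f]
   has weighted degree [d]. *)
HB.instance Definition _ (n : nat) (w : n.-tuple nat) :=
  isMeasure.Build n (wdeg w) (wdeg0 w) (@wdegD n w).

Section Lojasiewicz.
Context (R : realType) (n : nat).

(* The complex numbers are [R[i]]; the regular module [R[i]^o] carries their
   topology and their structure of normed module over themselves, so that
   derivatives below are complex derivatives. *)
Local Notation C := (R[i]^o).

Definition mpoly_fun (f : {mpoly R[i][n]}) : 'rV[C]_n -> C :=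
  fun z => f.@[z ord0].

(* The norm of the library on ['rV[C]_n] is the sup norm, with values in [R[i]];
   this is the real-valued Euclidean (Hermitian) one. *)
Definition eucl_norm (z : 'rV[C]_n) : R :=
  Num.sqrt (\sum_(i < n) Normc.normc (z ord0 i) ^+ 2).

Definition grad (F : 'rV[C]_n -> C) (z : 'rV[C]_n) : 'rV[C]_n :=
  \row_(i < n) 'D_(delta_mx ord0 i) F z.

Definition isolated_critical_point (F : 'rV[C]_n -> C) (p : 'rV[C]_n) : Prop :=
  grad F p = 0 /\ \forall z \near p^', grad F z != 0.

(* The infimum is taken in the extended reals, so that it is [+oo] when no
   exponent is admissible. *)
Definition lojasiewicz_exponent (F : 'rV[C]_n -> C) : \bar R :=
  ereal_inf [set lambda%:E | lambda in [set lambda : R | 0 < lambda /\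
    exists2 c : R, 0 < c &
      \forall z \near (0 : 'rV[C]_n),
        c * eucl_norm z `^ lambda <= eucl_norm (grad F z)]].

End Lojasiewicz.

(* Main.v *)
Require Import Defs.
From mathcomp Require Import all_boot all_order all_algebra.
From mathcomp Require Import complex.
From mathcomp Require Import mpoly.
From mathcomp Require Import boolp classical_sets reals ereal exp.
From mathcomp Require Import topology normedtype derive.
From mathcomp Require Import ring lra zify.

(** Write f_i for the partial derivatives of f and w_0 for the smallest weight,
    attained at the index i0, so that the maximum in the statement is
    (d - w_0) / w_0.  Each f_i is weighted homogeneous of degree d - w_i, and
    everything is measured along the orbits
    t |-> (t^{w_1} x_1, ..., t^{w_n} x_n).

    Upper bound.  By homogeneity the gradient vanishes only at 0
    ([critical_point_unique]).  Compactness and scaling then give, for a point z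
    of quasi-norm t = max |z_j|^{1/w_j}, an index i with
    |f_i(z)| >= c t^{d - w_i} ([quasi_norm_ge]).  For t <= 1 this is at least
    c t^{d - w_0}, whereas |z| = O(t^{w_0}); so (d - w_0) / w_0 is an admissible
    exponent ([lojasiewicz_admissible]).

    Lower bound.  It suffices to find a point x with x_{i0} = 1 at which f_i
    vanishes for every i of weight larger than w_0 ([polar_point_exists]): along
    its orbit the gradient is O(t^{d - w_0}) while |z| >= t^{w_0}
    ([lojasiewicz_lower_bound]).  If all weights are equal, any x will do.
    Otherwise d >= 2 w_i implies d > w_0 + w_i for every i, and it is enough to
    find a critical point of the polynomial F(y) = f(1, y) obtained by setting
    the variable of index i0 to 1.

    Existence of this critical point.  Let s = F - sum_i y_i F_i, the Legendre
    transform of F.  Along a path y(t) with grad F (y(t)) = b(t) one has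
    ds = - <y, db>.  On the other hand Euler's identity reads
    w_0 f_{i0}(1, y) = d s + sum_i (d - w_i) y_i F_i(y), and as long as grad F
    stays bounded, f_{i0}(1, y) grows at least like t^{d - w_0}, t being the
    quasi-norm of (1, y).  Because d - w_0 exceeds every weight w_i, a point y
    with |y| >= r forces |s| to be much larger than r, whereas a path of bounded
    length contained in the box of radius r changes s by O(r) only.  Hence a
    lift of a path b never leaves a box fixed in advance
    ([dehomogenize_confined]), and a preimage y(0) of b(0) can be continued
    along b until b reaches 0 ([continue_gradient_preimage]).

    The continuation needs an invertible Hessian along the path.  By a dimension
    count the critical values of the gradient map lie on a hypersurface Q = 0
    ([image_of_hypersurface]), which a straight path in a slightly rotated
    complex direction avoids ([ray_avoiding_roots]).  That the Hessian
    determinant is not identically zero is achieved by adding a small multiple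
    of sum_i y_i^2 to F; since the box does not depend on the two perturbations,
    compactness removes them ([critical_point_exists]). *)

Set Implicit Arguments.
Unset Strict Implicit.
Unset Printing Implicit Defensive.

Import Order.TTheory GRing.Theory Num.Theory.
Import numFieldNormedType.Exports.

Local Open Scope ring_scope.
Local Open Scope complex_scope.

(** * The modulus of a complex number as a real number *)

Section ComplexModulus.
Variable R : realType.
Local Notation C := R[i].
Local Notation normc := (@Normc.normc R).

Lemma normr_normc (z : C) : `|z| = (normc z)%:C.
Proof. by rewrite normc_def /normc; case: z. Qed.

Lemma normc_ge0 (z : C) : 0 <= normc z.
Proof. by case: z => a b; exact: sqrtr_ge0. Qed.

Lemma ler_normcD (x y : C) : normc (x + y) <= normc x + normc y.
Proof. by rewrite -lecR rmorphD -!normr_normc ler_normD. Qed.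

Lemma normcD_le (x y : C) a b :
  normc x <= a -> normc y <= b -> normc (x + y) <= a + b.
Proof. by move=> xa yb; apply: le_trans (ler_normcD x y) _; exact: lerD. Qed.

Lemma normcM_le (x y : C) a b :
  normc x <= a -> normc y <= b -> normc (x * y) <= a * b.
Proof. by move=> xa yb; rewrite Normc.normcM ler_pM ?normc_ge0. Qed.

Lemma normcN (x : C) : normc (- x) = normc x.
Proof. by apply: (@complexI R); rewrite -!normr_normc normrN. Qed.

Lemma normcB_sym (x y : C) : normc (x - y) = normc (y - x).
Proof. by rewrite -normcN opprB. Qed.

Lemma normcR (a : R) : normc a%:C = `|a|.
Proof. by rewrite /= expr0n /= addr0 sqrtr_sqr. Qed.

Lemma normcX (z : C) k : normc (z ^+ k) = normc z ^+ k.
Proof. by apply: (@complexI R); rewrite rmorphXn -!normr_normc normrX. Qed.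

Lemma normc_eq0 (z : C) : (normc z == 0) = (z == 0).
Proof.
apply/eqP/eqP => [|->]; first exact: Normc.eq0_normc.
exact: Normc.normc0.
Qed.

Lemma normc_gt0 (z : C) : (0 < normc z) = (z != 0).
Proof. by rewrite lt_def normc_ge0 andbT normc_eq0. Qed.

Lemma normc_sum_le (I : finType) (P : pred I) (F : I -> C) (a : I -> R) :
  (forall i, P i -> normc (F i) <= a i) ->
  normc (\sum_(i | P i) F i) <= \sum_(i | P i) a i.
Proof.
move=> h; elim/big_rec2: _ => [|i s t Pi st]; first by rewrite Normc.normc0.
by apply: normcD_le => //; exact: h.
Qed.

Lemma ler_normc_Re (z : C) : `|complex.Re z| <= normc z.
Proof.
case: z => a b /=; rewrite -sqrtr_sqr ler_sqrt ?lerDl ?sqr_ge0 //.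
by rewrite addr_ge0 ?sqr_ge0.
Qed.

Lemma normc_im (b : R) : normc (0 +i* b)%C = `|b|.
Proof. by rewrite /= expr0n /= add0r sqrtr_sqr. Qed.

Lemma ler_normc_Im (z : C) : `|complex.Im z| <= normc z.
Proof.
case: z => a b /=; rewrite -sqrtr_sqr ler_sqrt ?lerDr ?sqr_ge0 //.
by rewrite addr_ge0 ?sqr_ge0.
Qed.

Lemma ler_normc_ReIm (z : C) :
  normc z <= `|complex.Re z| + `|complex.Im z|.
Proof.
case: z => a b; have := ler_normcD a%:C (0 +i* b).
rewrite normcR normc_im; apply: le_trans.
by rewrite [X in _ <= normc X](_ : _ = a +i* b) // /GRing.add /= addr0 add0r.
Qed.

End ComplexModulus.

(** * Estimates for polynomials on boxes *)

Lemma fin_uniform_bound (R : realType) (I : finType)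
    (P : I -> R -> Prop) :
  (forall i K K', K <= K' -> P i K -> P i K') ->
  (forall i, exists2 K, 0 <= K & P i K) ->
  exists2 K, 0 <= K & forall i, P i K.
Proof.
move=> mono h.
have /choice[K KP] : forall i, exists K, 0 <= K /\ P i K.
  by move=> i; have [K] := h i; exists K.
have K0 i : 0 <= K i by case: (KP i).
exists (\sum_i K i) => [|i]; first by apply: sumr_ge0.
apply: mono (KP i).2; rewrite (bigD1 i) //= lerDl; exact: sumr_ge0.
Qed.

Lemma ler_sum_ord (R : realType) n (F : 'I_n -> R) c :
  (forall i, F i <= c) -> \sum_i F i <= n%:R * c.
Proof.
move=> Fc; rewrite mulr_natl -[in leRHS](card_ord n) -sumr_const.
by apply: ler_sum => i _.
Qed.

Section MpolyInduction.
Variables (n : nat) (A : ringType).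

(** All analytic estimates below are stable under sums and products, so they
    need only be checked on constants and variables. *)
Lemma mpoly_ring_ind (P : {mpoly A[n]} -> Prop) :
  (forall c, P c%:MP) -> (forall i, P 'X_i) ->
  (forall p q, P p -> P q -> P (p + q)) ->
  (forall p q, P p -> P q -> P (p * q)) ->
  forall p, P p.
Proof.
move=> Pc PX Pa Pm; elim/mpolyind => [|c m p _ _ Pp]; first by have := Pc 0;
  rewrite mpolyC0.
apply: Pa => //; rewrite -mul_mpolyC; apply: (Pm); first exact: Pc.
have P1 : P 1 by rewrite -mpolyC1; exact: Pc.
rewrite mpolyXE_id; apply: (big_ind P P1 Pm) => i _.
by elim: (m i) => [|k IH]; rewrite ?expr0 ?exprS //; apply: (Pm).
Qed.

Lemma mderiv_var (i j : 'I_n) : ('X_j : {mpoly A[n]})^`M(i) = (i == j)%:R.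
Proof.
rewrite mderivX mnm1E [j == i]eq_sym; case: eqP => [->|_]; last by rewrite scale0r.
rewrite (_ : (U_(j) - U_(j))%MM = 0%MM) ?mpolyX0 ?scale1r //.
by apply/mnmP => k; rewrite mnmBE subnn mnm0E.
Qed.

End MpolyInduction.

Section PolynomialEstimates.
Variables (R : realType) (n : nat).
Local Notation C := R[i].
Local Notation normc := (@Normc.normc R).
Implicit Types (p q : {mpoly C[n]}) (x y : 'I_n -> C) (r e : R).

Definition in_box r x := forall i, normc (x i) <= r.

Definition close_by e x y := forall i, normc (y i - x i) <= e.

Lemma mpoly_bounded p r :
  exists2 K, 0 <= K & forall x, in_box r x -> normc p.@[x] <= K.
Proof.
elim/mpoly_ring_ind: p => [c|i|p q [K K0 Kp] [L L0 Lq]|p q [K K0 Kp] [L L0 Lq]].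
- by exists (normc c) => [|x _]; [exact: normc_ge0|rewrite mevalC].
- exists `|r| => // x xr; rewrite mevalXU.
  by rewrite (le_trans (xr i)) // ler_norm.
- exists (K + L) => [|x xr]; first exact: addr_ge0.
  by rewrite mevalD normcD_le ?Kp ?Lq.
- exists (K * L) => [|x xr]; first exact: mulr_ge0.
  by rewrite mevalM normcM_le ?Kp ?Lq.
Qed.

Lemma mpoly_lipschitz p r :
  exists2 K, 0 <= K & forall x y e, in_box r x -> in_box r y ->
    close_by e x y -> normc (p.@[y] - p.@[x]) <= K * e.
Proof.
elim/mpoly_ring_ind: p => [c|i|p q [K K0 Kp] [L L0 Lq]|p q [K K0 Kp] [L L0 Lq]].
- by exists 0 => // x y e _ _ _; rewrite !mevalC subrr Normc.normc0 mul0r.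
- by exists 1 => // x y e _ _ xy; rewrite !mevalXU mul1r.
- exists (K + L) => [|x y e xr yr xy]; first exact: addr_ge0.
  rewrite (mevalD x) (mevalD y) [leRHS]mulrDl opprD addrACA.
  by apply: normcD_le; [exact: Kp|exact: Lq].
- have [A A0 Ap] := mpoly_bounded p r; have [B B0 Bq] := mpoly_bounded q r.
  exists (K * B + A * L) => [|x y e xr yr xy].
    by rewrite addr_ge0 ?mulr_ge0.
  have regroup (a b c d : C) : a * b - c * d = (a - c) * b + c * (b - d) by ring.
  rewrite (mevalM x) (mevalM y) regroup.
  rewrite [leRHS](_ : _ = K * e * B + A * (L * e)); last by ring.
  apply: normcD_le; apply: normcM_le.
  + exact: Kp.
  + exact: Bq.
  + exact: Ap.
  + exact: Lq.
Qed.

(** The differential of [p] at [x], applied to the displacement from [x] to [y]. *)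
Definition dpoly p x y : C := \sum_i (y i - x i) * (p^`M(i)).@[x].

Lemma dpoly_le p r :
  exists2 K, 0 <= K & forall x y e, in_box r x -> close_by e x y ->
    normc (dpoly p x y) <= K * e.
Proof.
have [K K0 Kp] : exists2 K, 0 <= K & forall i x, in_box r x -> normc
  (p^`M(i)).@[x] <= K.
  apply: fin_uniform_bound => [i K K' KK' h x xr|i].
    exact: le_trans (h x xr) KK'.
  exact: mpoly_bounded.
exists (\sum_(i < n) K) => [|x y e xr xy]; first by apply: sumr_ge0.
rewrite mulr_suml; apply: normc_sum_le => i _; rewrite mulrC.
by apply: normcM_le; [exact: Kp|exact: xy].
Qed.

(** The remainder of a product is the sum of the remainders of the factors, each
    multiplied by a bounded factor, and of the product of two first order
    terms. *)
Lemma mpoly_taylor p r :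
  exists2 K, 0 <= K & forall x y e, in_box r x -> in_box r y ->
    close_by e x y -> normc (p.@[y] - p.@[x] - dpoly p x y) <= K * e ^+ 2.
Proof.
elim/mpoly_ring_ind: p => [c|i|p q [K K0 Kp] [L L0 Lq]|p q [K K0 Kp] [L L0 Lq]].
- exists 0 => // x y e _ _ _; rewrite !mevalC subrr /dpoly big1 => [|j _].
    by rewrite subrr Normc.normc0 mul0r.
  by rewrite mderivC meval0 mulr0.
- exists 0 => // x y e _ _ _; rewrite !mevalXU /dpoly (bigD1 i) //= big1 => [|j ji].
    by rewrite mderiv_var eqxx meval1 mulr1 addr0 subrr Normc.normc0 mul0r.
  by rewrite mderiv_var (negbTE ji) meval0 mulr0.
- exists (K + L) => [|x y e xr yr xy]; first exact: addr_ge0.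
  have -> : dpoly (p + q) x y = dpoly p x y + dpoly q x y.
    rewrite /dpoly -[RHS]big_split; apply: eq_bigr => i _.
    by rewrite (mderivD i p q) (mevalD x) mulrDr.
  have regroup (a b c d s t : C) : a + b - (c + d) - (s + t) = (a - c - s) + (b -
    d - t) by ring.
  rewrite (mevalD x) (mevalD y) [leRHS]mulrDl regroup.
  by apply: normcD_le; [exact: Kp|exact: Lq].
- have [A A0 Ap] := mpoly_bounded p r; have [B B0 Bq] := mpoly_bounded q r.
  have [D D0 Dp] := dpoly_le p r; have [E E0 Eq] := mpoly_lipschitz q r.
  exists (K * B + A * L + D * E) => [|x y e xr yr xy].
    by rewrite !addr_ge0 ?mulr_ge0.
  have -> : dpoly (p * q) x y = dpoly p x y * q.@[x] + p.@[x] * dpoly q x y.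
    have split_sum (a b : C) : dpoly p x y * b + a * dpoly q x y =
        \sum_i ((y i - x i) * (p^`M(i)).@[x] * b
                + a * ((y i - x i) * (q^`M(i)).@[x])).
      by rewrite /dpoly mulr_sumr mulr_suml -big_split.
    rewrite split_sum; apply: eq_bigr => i _.
    rewrite (mderivM i p q) (mevalD x) 2!(mevalM x) mulrDr.
    by congr (_ + _); [exact: mulrA | exact: mulrCA].
  have regroup (a b c d s t : C) : a * b - c * d - (s * d + c * t) =
    (a - c - s) * b + c * (b - d - t) + s * (b - d) by ring.
  rewrite (mevalM x) (mevalM y) regroup.
  rewrite [leRHS](_ : _ = (K * e ^+ 2) * B + A * (L * e ^+ 2) + (D * e) * (E * e));
    last by ring.
  apply: normcD_le; first apply: normcD_le; apply: normcM_le.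
  + exact: Kp.
  + exact: Bq.
  + exact: Ap.
  + exact: Lq.
  + exact: Dp.
  + exact: Eq.
Qed.

End PolynomialEstimates.

(** * Minima on closed boxes *)

Section BoxMinimum.
Variables (R : realType) (n : nat).
Local Notation C := R[i].
Local Notation normc := (@Normc.normc R).

(** Lipschitz continuity is all the continuity needed for compactness arguments,
    and it follows directly from the estimates on polynomials. *)
Definition lipschitz_on_box r (phi : ('I_n -> C) -> R) :=
  exists2 K, 0 <= K & forall x y e, in_box r x -> in_box r y ->
    close_by e x y -> `|phi y - phi x| <= K * e.

Let cplx (v : 'rV[R]_(n + n)) : 'I_n -> C :=
  fun i => v ord0 (lshift n i) +i* v ord0 (rshift n i).

Let cplx_onto x : exists v, cplx v = x.
Proof.
exists (row_mx (\row_i complex.Re (x i)) (\row_i complex.Im (x i))).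
by apply/funext => i; rewrite /cplx row_mxEl row_mxEr !mxE; case: (x i).
Qed.

Let cplx_close (v v' : 'rV[R]_(n + n)) (e : R) :
  ball v (e / 2) v' -> close_by e (cplx v) (cplx v').
Proof.
move=> vv' i; apply: le_trans (ler_normc_ReIm _) _.
have h j : `|v' ord0 j - v ord0 j| <= e / 2.
  by rewrite distrC ltW //; exact: (vv'.2 ord0 j).
by rewrite [e]splitr; apply: lerD; exact: h.
Qed.

(** The box is the image of a compact set of real coordinate vectors of length
    [n + n], where the extreme value theorem applies. *)
Lemma box_min r (phi : ('I_n -> C) -> R) : 0 <= r -> lipschitz_on_box r phi ->
  exists2 x, in_box r x & forall y, in_box r y -> phi x <= phi y.
Proof.
move=> r0 [K K0 phiK].
pose A := [set v : 'rV[R]_(n + n) | in_box r (cplx v)]%classic.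
have A0 : (A !=set0)%classic.
  have [v vE] := cplx_onto (fun=> 0); exists v.
  by have : in_box r (cplx v) by rewrite vE => i; rewrite Normc.normc0.
have Acl : closed A.
  move=> v clv i; rewrite leNgt; apply/negP => rv.
  pose e := (normc (cplx v i) - r) / 2.
  have e0 : 0 < e by rewrite divr_gt0 ?subr_gt0.
  have [v' [Av' vv']] := clv _ (nbhsx_ballx v (e / 2) (divr_gt0 e0 (ltr0Sn _ 1))).
  have := cplx_close vv' i; have := Av' i; rewrite normcB_sym => h1 h2.
  have := ler_normcD (cplx v i - cplx v' i) (cplx v' i); rewrite subrK.
  move: h1 h2; rewrite /e; lra.
have Aco : compact A.
  apply: (@subclosed_compact _ _
    [set v : 'rV[R]_(n + n) | forall i, `[- r, r] (v ord0 i)]%classic) => //.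
    apply: (@rV_compact _ _ (fun=> `[- r, r]%classic)) => _.
    exact: segment_compact.
  move=> v Av i; rewrite /= in_itv /= -ler_norml; case: (split_ordP i) => j ->.
    exact: le_trans (ler_normc_Re _) (Av j).
  exact: le_trans (ler_normc_Im _) (Av j).
have phic : ({within A, continuous (phi \o cplx)})%classic.
  apply/subspace_continuousP => v Av; apply/cvgrPdist_le => e e0.
  pose d := e / (K + 1).
  have d0 : 0 < d by rewrite divr_gt0 // ltr_wpDl.
  rewrite near_withinE; near=> v' => Av'; rewrite distrC /=.
  have vv' : ball v (d / 2) v'.
    by near: v'; apply: nbhsx_ballx; rewrite divr_gt0.
  apply: le_trans (phiK _ _ d Av Av' (cplx_close vv')) _.
  by rewrite /d mulrCA ger_pMr // ler_pdivrMr ?ltr_wpDl // mul1r lerDl.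
have [v vA vmin] := compact_EVT_min A0 Aco phic.
exists (cplx v) => [|y yr]; first by move: vA; rewrite inE.
have [u uy] := cplx_onto y; rewrite -uy; apply: vmin.
by rewrite inE; have : in_box r (cplx u) by rewrite uy.
Unshelve. all: by end_near.
Qed.

(** This form turns approximate solutions in a fixed box into exact ones. *)
Lemma box_zero r (phi : ('I_n -> C) -> R) : 0 <= r -> lipschitz_on_box r phi ->
  (forall x, 0 <= phi x) ->
  (forall e, 0 < e -> exists2 x, in_box r x & phi x <= e) ->
  exists2 x, in_box r x & phi x = 0.
Proof.
move=> r0 phil phi0 small; have [x xr xmin] := box_min r0 phil.
exists x => //; apply/eqP; rewrite eq_le phi0 andbT leNgt; apply/negP => px.
have [y yr py] := small (phi x / 2) (divr_gt0 px (ltr0Sn _ 1)).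
by have := xmin y yr; lra.
Qed.

Lemma lipschitz_on_boxD r phi psi : lipschitz_on_box r phi ->
  lipschitz_on_box r psi -> lipschitz_on_box r (fun x => phi x + psi x).
Proof.
move=> [K K0 phiK] [L L0 psiL]; exists (K + L) => [|x y e xr yr xy].
  exact: addr_ge0.
rewrite mulrDl opprD addrACA; apply: le_trans (ler_normD _ _) _.
by apply: lerD; [exact: phiK|exact: psiL].
Qed.

Lemma lipschitz_on_box_cst r c : lipschitz_on_box r (fun=> c).
Proof. by exists 0 => // x y e _ _ _; rewrite subrr normr0 mul0r. Qed.

Lemma lipschitz_on_box_sum r (I : finType) (phi : I -> ('I_n -> C) -> R) :
  (forall i, lipschitz_on_box r (phi i)) ->
  lipschitz_on_box r (fun x => \sum_i phi i x).
Proof.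
move=> h; elim: (index_enum I) => [|i s IH].
  have -> : (fun x => \sum_(i <- [::]) phi i x) = fun=> 0.
    by apply/funext => x; rewrite big_nil.
  exact: lipschitz_on_box_cst.
have -> : (fun x => \sum_(j <- i :: s) phi j x) =
    fun x => phi i x + \sum_(j <- s) phi j x.
  by apply/funext => x; rewrite big_cons.
exact: lipschitz_on_boxD.
Qed.

Lemma lipschitz_on_box_comp r (psi : R -> R) phi :
  (forall u v, `|psi u - psi v| <= `|u - v|) ->
  lipschitz_on_box r phi -> lipschitz_on_box r (fun x => psi (phi x)).
Proof.
move=> psi1 [K K0 phiK]; exists K => // x y e xr yr xy.
exact: le_trans (psi1 _ _) (phiK x y e xr yr xy).
Qed.

Lemma lipschitz_on_box_normc r (p : {mpoly C[n]}) b :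
  lipschitz_on_box r (fun x => normc (p.@[x] - b)).
Proof.
have [K K0 pK] := mpoly_lipschitz p r; exists K => // x y e xr yr xy.
apply: le_trans (pK x y e xr yr xy).
have tri (s t : C) : normc s <= normc t + normc (s - t).
  by rewrite addrC -[in leLHS](subrK t s) ler_normcD.
have := tri (p.@[y] - b) (p.@[x] - b); have := tri (p.@[x] - b) (p.@[y] - b).
have E (s t : C) : s - b - (t - b) = s - t by ring.
by rewrite !E [normc (p.@[x] - p.@[y])]normcB_sym ler_norml; lra.
Qed.

End BoxMinimum.

(** * Polynomials vanishing on a box *)

Section VanishingOnBox.
Variables (R : realType) (n : nat).
Local Notation C := R[i].
Local Notation normc := (@Normc.normc R).
Implicit Types (p : {mpoly C[n]}) (c x : 'I_n -> C).

Lemma mpoly_const p : (forall i, p^`M(i) = 0) -> p = (p@_0)%:MP.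
Proof.
move=> dp; apply/mpolyP => m; rewrite mcoeffC.
have [->|m0] := eqVneq m 0%MM; first by rewrite mulr1.
have [i mi] : exists i, m i != 0%N.
  apply/existsP; rewrite -negb_forall; apply: contra m0 => /forallP h.
  by apply/eqP/mnmP => i; rewrite mnm0E; apply/eqP.
have -> : m = (m - U_(i) + U_(i))%MM.
  by rewrite submK //; apply/mnm_lepP => j; rewrite mnm1E; case: eqP => [<-|//]; lia.
have := mcoeff_mderiv i p (m - U_(i)); rewrite dp mcoeff0 => /esym/eqP.
by rewrite mulrn_eq0 /= => /eqP ->; rewrite mulr0.
Qed.

Lemma in_box_close c x r : close_by r c x ->
  in_box (\sum_i normc (c i) + r) x.
Proof.
move=> cx i; rewrite -[x i](subrK (c i)) addrC.
apply: normcD_le (cx i) => //; rewrite (bigD1 i) //= lerDl.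
by apply: sumr_ge0 => j _; exact: normc_ge0.
Qed.

(** If [p] vanishes at [x] and at [x + h e_i], Taylor's formula bounds [h] times
    the derivative by a multiple of [h ^ 2]; let [h] tend to 0. *)
Lemma mpoly_deriv_vanish p c r i : 0 < r ->
  (forall x, close_by r c x -> p.@[x] = 0) ->
  forall x, close_by (r / 2) c x -> (p^`M(i)).@[x] = 0.
Proof.
move=> r0 p0 x cx.
have r2 : r / 2 <= r by lra.
have cxr : close_by r c x by move=> j; exact: le_trans (cx j) r2.
have [K K0 pK] := mpoly_taylor p (\sum_i normc (c i) + r).
have small h : 0 < h -> h <= r / 2 -> normc (p^`M(i)).@[x] <= K * h.
  move=> h0 hr; pose y j := x j + if j == i then h%:C else 0.
  have xy j : normc (y j - x j) = if j == i then h else 0.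
    rewrite /y addrC addKr; case: eqP => _; last exact: Normc.normc0.
    by rewrite normcR ger0_norm // ltW.
  have cy : close_by r c y.
    move=> j; rewrite -(subrK (x j) (y j)) -addrA [r]splitr; apply: normcD_le => //.
    by rewrite xy; case: eqP => // _; rewrite divr_ge0 // ltW.
  have xyh : close_by h x y by move=> j; rewrite xy; case: eqP => // _; exact: ltW.
  have := pK x y h (in_box_close cxr) (in_box_close cy) xyh.
  rewrite (p0 _ cxr) (p0 _ cy) subrr sub0r normcN /dpoly (bigD1 i) //= big1 => [|j ji].
    rewrite /y eqxx addr0 addrC addKr Normc.normcM normcR (ger0_norm (ltW h0)).
    by rewrite expr2 mulrCA ler_pM2l.
  by rewrite /y (negbTE ji) addr0 subrr mul0r.
apply/eqP; rewrite -normc_eq0 eq_le normc_ge0 andbT.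
rewrite leNgt; apply/negP => pos; set a := normc _ in small pos.
pose h := Num.min (r / 2) (a / (2 * (K + 1))).
have h0 : 0 < h by rewrite lt_min !divr_gt0 // mulr_gt0 // ltr_wpDl.
have hr : h <= r / 2 by rewrite ge_min lexx.
have ha : h <= a / (2 * (K + 1)) by rewrite ge_min lexx orbT.
have := small h h0 hr; apply/negP; rewrite -ltNge.
have : h * (2 * (K + 1)) <= a by rewrite -ler_pdivlMr // mulr_gt0 // ltr_wpDl.
nra.
Qed.

(** Induction on the degree: the derivatives vanish on a smaller box, hence are
    zero, so [p] is a constant. *)
Lemma mpoly_vanish_box p c r : 0 < r ->
  (forall x, close_by r c x -> p.@[x] = 0) -> p = 0.
Proof.
have [k] := ubnP (msize p); elim: k => // k IH in p r * => pk r0 p0.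
have dp i : p^`M(i) = 0.
  have [//|d0] := eqVneq (p^`M(i)) 0.
  apply: (IH _ (r / 2)); rewrite ?divr_gt0 //; last exact: mpoly_deriv_vanish.
  rewrite -(mlead_deg d0).
  have := mlead_supp d0; rewrite mcoeff_msupp mcoeff_mderiv mulrn_eq0 /=.
  by rewrite -mcoeff_msupp => /msize_mdeg_lt;
    rewrite mdegD mdeg1 addn1 => /leq_trans h; exact: h pk.
have cc : close_by r c c by move=> i; rewrite subrr Normc.normc0 ltW.
by move: (p0 c cc); rewrite (mpoly_const dp) mevalC => ->; rewrite mpolyC0.
Qed.

End VanishingOnBox.

(** * The image of a hypersurface lies on a hypersurface *)

Section Elimination.

Lemma underdetermined (K : fieldType) (X Y : finType) (m : X -> Y -> K) :
  (#|Y| < #|X|)%N ->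
  exists2 c : X -> K, exists x, c x != 0 & forall y, \sum_x c x * m x y = 0.
Proof.
move=> YX; pose M := \matrix_(a < #|X|, b < #|Y|) m (enum_val a) (enum_val b).
have /rowV0Pn[v /sub_kermxP vM v0] : kermx M != 0.
  rewrite -mxrank_eq0 mxrank_ker -lt0n subn_gt0.
  exact: leq_ltn_trans (rank_leq_col M) YX.
exists (fun x => v ord0 (enum_rank x)) => [|y].
  have /rV0Pn[a va] := v0.
  by exists (enum_val a); rewrite enum_valK.
have := congr1 (fun u : 'rV_#|Y| => u ord0 (enum_rank y)) vM.
rewrite !mxE => vMy; rewrite -[RHS]vMy (reindex_onto enum_rank enum_val) /=.
  apply: eq_big => [x|x _]; first by rewrite enum_rankK eqxx.
  by rewrite !mxE !enum_rankK.
by move=> a _; rewrite enum_valK.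
Qed.

Lemma expn_box_gap a e k :
  ((a + e) ^ k.+1 <= a ^ k.+1 + k.+1 * e * (a + e) ^ k)%N.
Proof.
elim: k => [|k IH]; first by rewrite !expn1 expn0; lia.
rewrite expnS mulnDl.
have : (a * (a + e) ^ k.+1 <= a * a ^ k.+1 + k.+1 * e * (a + e) ^ k.+1)%N.
  apply: leq_trans (leq_mul (leqnn a) IH) _.
  rewrite mulnDr leq_add2l mulnCA leq_mul2l orbC.
  by rewrite (expnS (a + e)) leq_mul2r leq_addr orbT.
rewrite -expnS; lia.
Qed.

(** Monomials with all exponents at most [M] number [M.+1 ^ N].  The left-hand
    side counts the coefficients of a polynomial with exponents at most
    [N * D * T + D], the right-hand side those of a polynomial [Q] with exponents
    at most [T] and of a cofactor [B] with exponents at most [N * D * T]: the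
    difference of the two powers with base of order [T] has only order
    [T ^ N.-1]. *)
Lemma box_count N D : (0 < D)%N -> exists T,
  ((N * D * T + D).+1 ^ N < T.+1 ^ N + (N * D * T).+1 ^ N)%N.
Proof.
move=> D0; case: N => [|N]; first by exists 0%N; rewrite !expn0.
pose G := (N.+1 * D + D + 1)%N.
exists (N.+1 * D * G ^ N)%N; set T := (_ * G ^ N)%N; set S := (_ * T)%N.
have -> : (S + D).+1 = (S.+1 + D)%N by lia.
apply: leq_ltn_trans (expn_box_gap _ _ _) _.
rewrite addnC ltn_add2r [ltnRHS]expnS.
have : ((S.+1 + D) ^ N <= G ^ N * T.+1 ^ N)%N.
  rewrite -expnMn; case: N {D0} @G @T @S => [|N] G T S; first by rewrite !expn0.
  rewrite leq_exp2r //; rewrite /S /G; nia.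
move=> le; apply: leq_ltn_trans (leq_mul (leqnn _) le) _.
by rewrite mulnA ltn_mul2r expn_gt0 ltnSn.
Qed.

Variables (K : fieldType) (N : nat).
Implicit Types p q : {mpoly K[N]}.

Definition exponents_le D p := forall m, m \in msupp p -> forall i, (m i <= D)%N.

Lemma exponents_le_widen D E p : (D <= E)%N -> exponents_le D p -> exponents_le E p.
Proof. by move=> DE h m mp i; exact: leq_trans (h m mp i) DE. Qed.

Lemma exponents_le_msize p : exponents_le (msize p) p.
Proof.
move=> m mp i; apply: leq_trans (ltnW (msize_mdeg_lt mp)).
by rewrite mdegE (bigD1 i) //= leq_addr.
Qed.

Lemma exponents_leM D E p q :
  exponents_le D p -> exponents_le E q -> exponents_le (D + E) (p * q).
Proof.
move=> hp hq m /msuppM_le /allpairsP[[m1 m2] /= [m1p m2q ->]] i.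
by rewrite mnmDE leq_add ?hp ?hq.
Qed.

Lemma exponents_leX D p k : exponents_le D p -> exponents_le (k * D) (p ^+ k).
Proof.
move=> hp; elim: k => [|k IH].
  by rewrite expr0 => m; rewrite msupp1 inE => /eqP -> i; rewrite mnm0E.
by rewrite exprS mulSn; exact: exponents_leM.
Qed.

Lemma exponents_le_prod (I : finType) (F : I -> {mpoly K[N]}) E :
  (forall i, exponents_le E (F i)) -> exponents_le (#|I| * E) (\prod_i F i).
Proof.
move=> hF; rewrite cardE mulnC /index_enum -enumT; elim: (enum I) => [|i s IH].
  by rewrite big_nil => m; rewrite msupp1 inE => /eqP -> i; rewrite mnm0E.
by rewrite big_cons /= mulnS; exact: exponents_leM.
Qed.

Lemma exponents_le_sum (I : finType) (F : I -> {mpoly K[N]}) E :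
  (forall i, exponents_le E (F i)) -> exponents_le E (\sum_i F i).
Proof.
move=> hF; elim/big_ind: _ => // [|p q hp hq] m; first by rewrite msupp0.
by move=> /msuppD_le; rewrite mem_cat => /orP[/hp|/hq].
Qed.

Definition box_mnm M (a : {ffun 'I_N -> 'I_M.+1}) : 'X_{1..N} :=
  [multinom (a i : nat) | i < N].

Lemma box_mnm_inj M : injective (@box_mnm M).
Proof.
move=> a b /mnmP ab; apply/ffunP => i; apply: val_inj.
by have := ab i; rewrite !mnmE.
Qed.

Lemma exponents_leE M p : exponents_le M p ->
  (forall a : {ffun 'I_N -> 'I_M.+1}, p@_(box_mnm a) = 0) -> p = 0.
Proof.
move=> hp p0; apply/mpolyP => m; rewrite mcoeff0.
have [mp|/memN_msupp_eq0 //] := boolP (m \in msupp p).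
rewrite -(p0 [ffun i => inord (m i)]); congr (_@__).
by apply/mnmP => i; rewrite mnmE ffunE inordK // ltnS hp.
Qed.

Lemma mcoeff_box_sum M (c : {ffun 'I_N -> 'I_M.+1} -> K) a :
  (\sum_b c b *: 'X_[box_mnm b])@_(box_mnm a) = c a.
Proof.
rewrite linear_sum (bigD1 a) //= mcoeffZ mcoeffX eqxx mulr1 big1 ?addr0 //.
move=> b ba; rewrite mcoeffZ mcoeffX (inj_eq (@box_mnm_inj M)).
by rewrite (negbTE ba) mulr0.
Qed.

(** A nonzero [Q] is found such that [J] divides [Q \o Phi]: the equation
    [Q \o Phi = J * B] is linear in the coefficients of [Q] and [B], and
    [box_count] makes the unknowns outnumber the equations when large degrees
    are allowed.  A solution with [Q = 0] would have [J * B = 0], hence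
    [B = 0]. *)
Lemma image_of_hypersurface (Phi : 'I_N -> {mpoly K[N]}) (J : {mpoly K[N]}) :
  J != 0 -> exists2 Q : {mpoly K[N]}, Q != 0 &
    forall z, J.@[z] = 0 -> Q.@[fun i => (Phi i).@[z]] = 0.
Proof.
move=> J0.
pose D := (\sum_i msize (Phi i) + msize J).+1.
have hPhi i : exponents_le D (Phi i).
  apply: exponents_le_widen (@exponents_le_msize _).
  by rewrite /D (bigD1 i) //= -!addnA addnA -addSn; lia.
have hJ : exponents_le D J.
  by apply: exponents_le_widen (@exponents_le_msize _); rewrite /D; lia.
have [T count] := box_count N (ltn0Sn _ : (0 < D)%N).
set M' := (N * D * T)%N in count; pose M := (M' + D)%N.
pose X := ({ffun 'I_N -> 'I_T.+1} + {ffun 'I_N -> 'I_M'.+1})%type.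
pose g (x : X) : {mpoly K[N]} := match x with
  | inl a => \prod_i Phi i ^+ (a i : nat)
  | inr b => - (J * 'X_[box_mnm b])
  end.
have hg x : exponents_le M (g x).
  case: x => [a|b] /=.
    apply: (@exponents_le_widen (#|'I_N| * (T * D)));
      first by rewrite card_ord /M /M'; lia.
    apply: exponents_le_prod => i.
    apply: (@exponents_le_widen (a i * D)); last exact: exponents_leX.
    by rewrite leq_mul2r -ltnS ltn_ord orbT.
  suff hJb : exponents_le M (J * 'X_[box_mnm b]).
    by move=> m; rewrite (perm_mem (msuppN _)); exact: hJb.
  rewrite /M addnC; apply: exponents_leM => // m; rewrite msuppX inE => /eqP -> i.
  by rewrite mnmE -ltnS ltn_ord.
have [|c [x0 cx0] ceq] := @underdetermined K X {ffun 'I_N -> 'I_M.+1}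
    (fun x y => (g x)@_(box_mnm y)).
  by rewrite card_sum !card_ffun !card_ord.
have S0 : \sum_x c x *: g x = 0.
  apply: (@exponents_leE M).
    apply: exponents_le_sum => x m /msuppZ_le; exact: hg.
  move=> y; rewrite -[RHS](ceq y) linear_sum; apply: eq_bigr => x _.
  exact: mcoeffZ.
pose Q := \sum_a c (inl a) *: 'X_[box_mnm a] : {mpoly K[N]}.
pose B := \sum_b c (inr b) *: 'X_[box_mnm b] : {mpoly K[N]}.
have SE : \sum_x c x *: g x =
    \sum_(a : {ffun 'I_N -> 'I_T.+1}) c (inl a) *: \prod_i Phi i ^+ (a i : nat) - J * B.
  rewrite big_sumType /=; congr (_ + _).
  rewrite /B mulr_sumr -sumrN; apply: eq_bigr => b _.
  by rewrite scalerN scalerAr.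
exists Q => [|z Jz].
  apply/eqP => Q0; move: cx0 => /eqP; apply.
  have c0 a : c (inl a) = 0.
    by have := mcoeff_box_sum (fun a => c (inl a)) a; rewrite -/Q Q0 mcoeff0.
  have B0 : B = 0.
    move: S0; rewrite SE big1 => [|a _]; last by rewrite c0 scale0r.
    by move/eqP; rewrite sub0r oppr_eq0 mulf_eq0 (negbTE J0) => /eqP.
  case: x0 => [//|b].
  by have := mcoeff_box_sum (fun b => c (inr b)) b; rewrite -/B B0 mcoeff0.
have := congr1 (meval z) S0; rewrite SE mevalB mevalM Jz mul0r subr0 meval0 => S0z;
  rewrite -[RHS]S0z.
rewrite !raddf_sum; apply: eq_bigr => a _; rewrite /= !mevalZ; congr (_ * _).
rewrite mevalX rmorph_prod; apply: eq_bigr => i _.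
by rewrite mnmE rmorphXn.
Qed.

End Elimination.

(** * Local inversion of polynomial maps *)

Section LocalInversion.
Variables (R : realType) (n : nat).
Local Notation C := R[i].
Local Notation normc := (@Normc.normc R).
Implicit Types (Phi : 'I_n -> {mpoly C[n]}) (x y z b : 'I_n -> C).

Definition jacobian Phi : 'M[{mpoly C[n]}]_n :=
  \matrix_(i, j) (Phi i)^`M(j).

Definition jacobian_at Phi x : 'M[C]_n := map_mx (meval x) (jacobian Phi).

Lemma det_jacobian_at Phi x : \det (jacobian_at Phi x) = (\det (jacobian Phi)).@[x].
Proof. exact: det_map_mx. Qed.

Lemma dpolyE Phi i x y :
  dpoly (Phi i) x y = (jacobian_at Phi x *m \col_j (y j - x j)) i ord0.
Proof. by rewrite !mxE; apply: eq_bigr => j _; rewrite !mxE mulrC. Qed.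

Lemma mulmx_col_le (A : 'M[C]_n) : exists2 a, 0 <= a &
  forall (u : 'cV[C]_n) e, (forall i, normc (u i ord0) <= e) ->
    forall i, normc ((A *m u) i ord0) <= a * e.
Proof.
have [a a0 aA] : exists2 a, 0 <= a & forall i (u : 'cV[C]_n) e,
    (forall i, normc (u i ord0) <= e) -> normc ((A *m u) i ord0) <= a * e.
  apply: fin_uniform_bound => [i K K' KK' h u e ue|i].
    apply: le_trans (h u e ue) _; rewrite ler_wpM2r //.
    exact: le_trans (normc_ge0 _) (ue i).
  exists (\sum_j normc (A i j)) => [|u e ue]; first by apply: sumr_ge0 => j _;
    exact: normc_ge0.
  rewrite mxE mulr_suml; apply: normc_sum_le => j _.
  by apply: normcM_le.
by exists a => // u e ue i; exact: aA.
Qed.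

Lemma lipschitz_on_box_shift r s phi z : lipschitz_on_box (s + r) phi ->
  in_box s z -> lipschitz_on_box r (fun u : 'I_n -> C => phi (fun i => z i + u i)).
Proof.
move=> [K K0 phiK] zs; exists K => // x y e xr yr xy; apply: phiK => i.
- exact: normcD_le (zs i) (xr i).
- exact: normcD_le (zs i) (yr i).
- by rewrite opprD addrACA subrr add0r.
Qed.

Definition max_normc x : R := \big[Num.max/0]_i normc (x i).

Lemma max_normc_le x e : 0 <= e -> in_box e x -> max_normc x <= e.
Proof. by move=> e0 xe; apply: bigmax_le => // i _; exact: xe. Qed.

Lemma le_max_normc x : in_box (max_normc x) x.
Proof. by move=> i; apply: (le_bigmax 0 (fun i => normc (x i)) i). Qed.

Lemma max_normc_ge0 x : 0 <= max_normc x.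
Proof. exact: bigmax_ge_id. Qed.

Lemma polymap_taylor Phi r :
  exists2 K, 0 <= K & forall i x y e, in_box r x -> in_box r y -> close_by e x y ->
    normc ((Phi i).@[y] - (Phi i).@[x] - dpoly (Phi i) x y) <= K * e ^+ 2.
Proof.
apply: fin_uniform_bound => [i K K' KK' h x y e xr yr xy|i].
  apply: le_trans (h x y e xr yr xy) _.
  by rewrite ler_wpM2r // sqr_ge0.
exact: mpoly_taylor.
Qed.

(** Multiplying Taylor's formula by the inverse Jacobian matrix bounds the
    distance [d] from [z] to [x] by [a * (e + K * d ^ 2)]; for [d] small the
    quadratic term is absorbed in the left-hand side. *)
Lemma quantitative_injectivity Phi z : \det (jacobian_at Phi z) != 0 ->
  exists2 a, 0 <= a & exists2 r, 0 < r & forall x e, 0 <= e -> close_by r z x ->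
    (forall i, normc ((Phi i).@[x] - (Phi i).@[z]) <= e) -> close_by (a * e) z x.
Proof.
move=> Jz; pose A := jacobian_at Phi z.
have Au : A \in unitmx by rewrite unitmxE unitfE.
have [a a0 ha] := mulmx_col_le (invmx A).
pose s := \sum_i normc (z i) + 1.
have [K K0 hK] := polymap_taylor Phi s.
have s1 : 0 <= s by rewrite addr_ge0 // sumr_ge0 // => i _; exact: normc_ge0.
have zs : in_box s z.
  by apply: in_box_close => i; rewrite subrr Normc.normc0.
pose r := (2 * a * K + 1)^-1.
have aK : 0 <= 2 * a * K by rewrite !mulr_ge0.
have r0 : 0 < r by rewrite invr_gt0 ltr_wpDl.
have r1 : r <= 1 by rewrite invf_le1 ?ltr_wpDl // lerDr.
exists (2 * a); first by rewrite mulr_ge0.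
exists r => // x e e0 zx hx.
have xs : in_box s x.
  by apply: in_box_close => i; exact: le_trans (zx i) r1.
pose d := max_normc (fun i => x i - z i).
have d0 : 0 <= d := max_normc_ge0 _.
have zxd : close_by d z x := le_max_normc _.
have dr : d <= r by apply: max_normc_le => //; exact: ltW.
suff dle : d <= 2 * a * e by move=> i; exact: le_trans (zxd i) dle.
have step i : normc (x i - z i) <= a * (e + K * d ^+ 2).
  have -> : x i - z i = (invmx A *m (A *m \col_j (x j - z j))) i ord0.
    by rewrite mulmxA mulVmx // mul1mx mxE.
  apply: ha => j; rewrite -dpolyE.
  rewrite -[dpoly _ _ _](subKr ((Phi j).@[x] - (Phi j).@[z])).
  by apply: normcD_le; rewrite ?hx // normcN hK.
have : d <= a * (e + K * d ^+ 2).
  by apply: max_normc_le => //; rewrite mulr_ge0 // addr_ge0 // mulr_ge0 // sqr_ge0.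
have : 2 * a * K * d <= 1.
  have h : 2 * a * K * d <= 2 * a * K * r by rewrite ler_wpM2l.
  apply: le_trans h _; rewrite /r ler_pdivrMr ?ltr_wpDl //; lra.
rewrite expr2; nra.
Qed.

(** Newton's direction: moving from [x] by [t] times the inverse Jacobian matrix
    applied to the residual multiplies the latter by [1 - t], up to a term of
    order [t ^ 2]. *)
Lemma residual_decrease Phi b x : \det (jacobian_at Phi x) != 0 ->
  0 < \sum_i normc ((Phi i).@[x] - b i) ->
  forall r, 0 < r -> exists2 y, close_by r x y &
    \sum_i normc ((Phi i).@[y] - b i) < \sum_i normc ((Phi i).@[x] - b i).
Proof.
move=> Jx; set S := \sum_i _ => S0 r r0; pose A := jacobian_at Phi x.
have Au : A \in unitmx by rewrite unitmxE unitfE.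
pose v := invmx A *m \col_i (b i - (Phi i).@[x]).
pose V := max_normc (fun i => v i ord0) + 1.
have V0 : 0 < V by rewrite ltr_wpDl // max_normc_ge0.
have vV i : normc (v i ord0) <= V.
  by apply: le_trans (le_max_normc (fun i => v i ord0) i) _; rewrite lerDl.
pose s := \sum_i normc (x i) + r.
have [K K0 hK] := polymap_taylor Phi s.
pose N := n%:R : R.
have N0 : 0 <= N by rewrite ler0n.
pose Q := N * K * V ^+ 2.
have Q0 : 0 <= Q by rewrite /Q mulr_ge0 ?sqr_ge0 // mulr_ge0.
pose t := Num.min (Num.min 1 (r / V)) (S / (2 * (Q + 1))).
have t0 : 0 < t by rewrite !lt_min ltr01 !divr_gt0 // mulr_gt0 // ltr_wpDl.
have t1 : t <= 1 by rewrite !ge_min lexx.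
have tr : t * V <= r by rewrite -ler_pdivlMr // !ge_min lexx orbT.
have tS : t * (2 * (Q + 1)) <= S.
  by rewrite -ler_pdivlMr ?mulr_gt0 ?ltr_wpDl // !ge_min lexx !orbT.
pose y i := x i + t%:C * v i ord0.
have xyt : close_by (t * V) x y.
  by move=> i; rewrite /y addrC addKr normcM_le // normcR ger0_norm // ltW.
have xy : close_by r x y by move=> i; exact: le_trans (xyt i) tr.
have xx : close_by r x x by move=> i; rewrite subrr Normc.normc0 ltW.
exists y => //.
have step i : normc ((Phi i).@[y] - b i) <=
    (1 - t) * normc ((Phi i).@[x] - b i) + K * (t * V) ^+ 2.
  have := hK i x y (t * V) (in_box_close xx) (in_box_close xy) xyt.
  have -> : dpoly (Phi i) x y = t%:C * (b i - (Phi i).@[x]).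
    rewrite dpolyE (_ : \col_j _ = t%:C *: v).
      by rewrite -scalemxAr mulmxA mulmxV // mul1mx !mxE.
    by apply/colP => j; rewrite mxE [RHS]mxE /y addrC addKr.
  have -> : (1 - t) * normc ((Phi i).@[x] - b i) =
      normc ((1 - t)%:C * ((Phi i).@[x] - b i)).
    by rewrite Normc.normcM normcR ger0_norm // subr_ge0.
  move=> h; apply: le_trans _ (lerD (lexx _) h).
  apply: le_trans (ler_normcD _ _); rewrite le_eqVlt; apply/orP; left; apply/eqP.
  congr normc; rewrite rmorphB rmorph1; ring.
apply: (@le_lt_trans _ _ (\sum_i ((1 - t) * normc ((Phi i).@[x] - b i) + K * (t *
  V) ^+ 2))).
  by apply: ler_sum.
rewrite big_split /= -mulr_sumr -/S sumr_const card_ord -mulr_natl -/N.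
have -> : N * (K * (t * V) ^+ 2) = t * (t * Q) by rewrite /Q; ring.
have : t * Q < S.
  have : t * Q <= t * (Q + 1) by rewrite ler_wpM2l ?lerDl // ltW.
  move: tS; nra.
move=> h; have : t * (t * Q) < t * S by rewrite ltr_pM2l.
lra.
Qed.

(** The residual [phi] attains its minimum on a small closed ball around [z].
    [quantitative_injectivity] keeps the minimiser away from the boundary, where
    a nonzero residual could still be decreased by [residual_decrease]. *)
Lemma local_inversion Phi z : \det (jacobian_at Phi z) != 0 ->
  exists2 a, 0 <= a & exists2 d, 0 < d & forall b e, 0 <= e -> e <= d ->
    (forall i, normc (b i - (Phi i).@[z]) <= e) ->
    exists2 x, close_by (a * e) z x & forall i, (Phi i).@[x] = b i.
Proof.
move=> Jz; have [a a0 [r0 r0_gt0 inj]] := quantitative_injectivity Jz.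
pose s := \sum_i normc (z i).
have s0 : 0 <= s by apply: sumr_ge0 => i _; exact: normc_ge0.
have zs : in_box s z.
  by have := @in_box_close _ _ z z 0; rewrite addr0; apply=> i;
    rewrite subrr Normc.normc0.
have [L L0 hL] := mpoly_lipschitz (\det (jacobian Phi)) (s + 1).
pose J := normc (\det (jacobian_at Phi z)).
have J0 : 0 < J by rewrite normc_gt0.
pose r := Num.min (Num.min r0 1) (J / (2 * (L + 1))).
have r_gt0 : 0 < r by rewrite !lt_min r0_gt0 ltr01 divr_gt0 // mulr_gt0 // ltr_wpDl.
have rr0 : r <= r0 by rewrite !ge_min lexx.
have r1 : r <= 1 by rewrite !ge_min lexx !orbT.
have rJ : r * (2 * (L + 1)) <= J.
  by rewrite -ler_pdivlMr ?mulr_gt0 ?ltr_wpDl // !ge_min lexx !orbT.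
have Jx x : close_by r z x -> \det (jacobian_at Phi x) != 0.
  move=> zx; rewrite -normc_gt0.
  have h : normc (\det (jacobian_at Phi x) - \det (jacobian_at Phi z)) <= L * r.
    rewrite !det_jacobian_at; apply: hL => //.
      by move=> i; apply: le_trans (zs i) _; rewrite lerDl.
    by apply: in_box_close => i; exact: le_trans (zx i) r1.
  have := ler_normcD (\det (jacobian_at Phi z) - \det (jacobian_at Phi x)) (\det
    (jacobian_at Phi x)).
  rewrite subrK normcB_sym -/J; nra.
pose N := n%:R : R.
have N0 : 0 <= N by rewrite ler0n.
pose c := a * (N + 1).
have c0 : 0 <= c by rewrite mulr_ge0 // addr_ge0.
pose d := r / (2 * (c + 1)).
have d0 : 0 < d by rewrite divr_gt0 // mulr_gt0 // ltr_wpDl.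
exists c => //; exists d => // b e e0 ed hb.
pose phi x := \sum_i normc ((Phi i).@[x] - b i).
have phil t : lipschitz_on_box t phi.
  by apply: lipschitz_on_box_sum => i; exact: lipschitz_on_box_normc.
have [u ur umin] := box_min (ltW r_gt0) (lipschitz_on_box_shift (phil _) zs).
pose x i := z i + u i.
have zx : close_by r z x by move=> i; rewrite /x addrC addKr.
have xmin y : close_by r z y -> phi x <= phi y.
  move=> zy; rewrite /x; have := umin (fun i => y i - z i) zy.
  by rewrite (_ : (fun i => z i + (y i - z i)) = y) //; apply/funext => i;
    rewrite addrC subrK.
have phix : phi x <= N * e.
  apply: le_trans (xmin z _) _; first by move=> i; rewrite subrr Normc.normc0 ltW.
  by apply: ler_sum_ord => i; rewrite normcB_sym.
have phi0 y : 0 <= phi y by apply: sumr_ge0 => i _; exact: normc_ge0.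
have zxe : close_by (c * e) z x.
  rewrite /c -mulrA; apply: inj.
  - by rewrite mulr_ge0 // addr_ge0.
  - by move=> i; exact: le_trans (zx i) rr0.
  have regroup (s1 t1 b1 : C) : s1 - t1 = (s1 - b1) + (b1 - t1) by ring.
  move=> i; rewrite mulrDl mul1r (regroup _ _ (b i)).
  apply: normcD_le => //; apply: le_trans phix.
  rewrite /phi (bigD1 i) //= lerDl; apply: sumr_ge0 => j _; exact: normc_ge0.
have ce : c * e <= r / 2.
  apply: (@le_trans _ _ (c * d)); first by rewrite ler_wpM2l.
  have : d * (2 * (c + 1)) = r by rewrite /d divfK // lt0r_neq0 // mulr_gt0 // ltr_wpDl.
  move: c0 d0; nra.
have phi_eq0 : phi x = 0.
  apply/eqP; rewrite eq_le phi0 andbT leNgt; apply/negP => phix0.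
  have r2 : 0 < r / 2 by rewrite divr_gt0.
  have [y xy] := residual_decrease (Jx x zx) phix0 r2.
  rewrite ltNge => /negP; apply.
  apply: xmin => i; rewrite -(subrK (x i) (y i)) -addrA [r]splitr.
  by apply: normcD_le (xy i) (le_trans (zxe i) ce).
exists x => // i; apply/eqP; rewrite -subr_eq0 -normc_eq0.
move/eqP: phi_eq0; rewrite psumr_eq0 => [|j _]; last exact: normc_ge0.
by move=> /allP/(_ i (mem_index_enum i)).
Qed.

End LocalInversion.

(** * Parameters and paths avoiding finitely many roots *)

Section AvoidingRoots.
Variable R : realType.
Local Notation C := R[i].

(** A polynomial has too few roots to spoil all the members of an infinite
    family of pairwise disjoint conditions. *)
Lemma injective_nonroot (p : {poly C}) (bad : nat -> C -> Prop) : p != 0 ->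
  (forall k l z, bad k z -> bad l z -> k = l) ->
  exists k, forall z, bad k z -> ~~ root p z.
Proof.
move=> p0 bad_inj; apply: contrapT => none.
have /choice[z hz] : forall k, exists z, bad k z /\ root p z.
  move=> k; apply: contrapT => nz; apply: none; exists k => z bz.
  by apply/negP => rz; apply: nz; exists z.
have : (size (map z (iota 0 (size p))) < size p)%N.
  apply: max_poly_roots => //.
    by apply/allP => _ /mapP[k _ ->]; case: (hz k).
  rewrite map_inj_in_uniq ?iota_uniq // => k l _ _ kl.
  by apply: (bad_inj k l (z k)); [case: (hz k)|rewrite kl; case: (hz l)].
by rewrite size_map size_iota ltnn.
Qed.

Lemma small_nonroot (p : {poly C}) (e : R) : p != 0 -> 0 < e ->
  exists2 x, 0 < x <= e & ~~ root p x%:C.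
Proof.
move=> p0 e0; have k0 k : 0 < k.+1%:R :> R by [].
have [|k hk] := @injective_nonroot p (fun k z => z = (e / k.+1%:R)%:C) p0.
  move=> k l z -> [] /(mulfI (lt0r_neq0 e0)) /invr_inj /eqP.
  by rewrite eqr_nat => /eqP[].
exists (e / k.+1%:R); last exact: hk.
rewrite divr_gt0 //= ler_pdivrMr // ler_peMr ?ler1n //; exact: ltW.
Qed.

(** Two real lines through the origin with different slopes meet only at 0, so
    each nonzero root spoils at most one of the slopes. *)
Lemma ray_avoiding_roots (q : {poly C}) (e : R) : q.[0] != 0 -> 0 < e ->
  exists2 h, 0 < h <= e & forall t : R, ~~ root q (t%:C * (1 +i* h)).
Proof.
move=> q0 e0; have k0 k : 0 < k.+1%:R :> R by [].
have qn0 : q != 0 by apply: contraNneq q0 => ->; rewrite horner0.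
have [|k hk] := @injective_nonroot q (fun k z => z != 0 /\
    exists t : R, z = t%:C * (1 +i* (e / k.+1%:R))) qn0.
  move=> k l z [z0 [t zt]] [_ [u zu]]; move: z0; rewrite zt => z0.
  have t0 : t != 0 by apply: contraNneq z0 => ->; rewrite mul0r.
  move: zu; rewrite zt => -[]; rewrite !mulr1 !mul0r !subr0 !addr0 => <-.
  move/(mulfI t0)/(mulfI (lt0r_neq0 e0))/invr_inj/eqP.
  by rewrite eqr_nat => /eqP[].
exists (e / k.+1%:R).
  by rewrite divr_gt0 //= ler_pdivrMr // ler_peMr ?ler1n //; exact: ltW.
move=> t; have [->|t0] := eqVneq t 0; first by rewrite mul0r.
apply: hk; split; last by exists t.
rewrite mulf_neq0 //; first by apply: contra t0 => /eqP[->].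
by apply/eqP => -[] /eqP; rewrite oner_eq0.
Qed.

Lemma small_det_shift n (A : 'M[C]_n) (e : R) : 0 < e ->
  exists2 x, 0 < x <= e & \det (A + x%:C%:M) != 0.
Proof.
move=> e0.
have [x xe rx] := small_nonroot (monic_neq0 (char_poly_monic (- A))) e0.
exists x => //; move: rx; rewrite /root /char_poly.
rewrite -[_.[_]]/(horner_eval x%:C _) -det_map_mx.
rewrite (_ : map_mx _ _ = A + x%:C%:M) //; apply/matrixP => i j.
by rewrite !mxE /= /horner_eval !hornerE hornerMn hornerX addrC opprK.
Qed.

Lemma poly_along_line n (Q : {mpoly C[n]}) (b : 'I_n -> C) :
  exists q : {poly C}, forall x, q.[x] = Q.@[fun i => b i * (1 - x)].
Proof.
exists (\sum_(m <- msupp Q) (Q@_m)%:P * \prod_i ((b i)%:P * (1 - 'X)) ^+ m i).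
move=> x; rewrite mevalE horner_sum; apply: eq_bigr => m _.
rewrite hornerM hornerC horner_prod; congr (_ * _); apply: eq_bigr => i _.
by rewrite horner_exp hornerM !hornerE.
Qed.

End AvoidingRoots.

(** * Continuation of gradient preimages *)

Section ContinuityMethod.
Variable R : realType.

Lemma continuity_method (T : R -> Prop) : T 0 ->
  (forall t, 0 <= t < 1 -> T t -> exists2 u, t < u <= 1 & T u) ->
  (forall s, 0 <= s <= 1 ->
    (forall e, 0 < e -> exists2 t, 0 <= t <= s & s - e < t /\ T t) -> T s) ->
  T 1.
Proof.
move=> T0 step lim.
pose S := [set t : R | 0 <= t <= 1 /\ T t]%classic.
have S0 : S 0 by split=> //; rewrite lexx ler01.
have ubS : ubound S 1 by move=> t [/andP[]].
have supS : has_sup S by split; [exists 0|exists 1].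
have s0 : 0 <= sup S by apply: sup_upper_bound.
have s1 : sup S <= 1 by apply: sup_le_ub => //; exists 0.
have Ts : T (sup S).
  apply: lim => [|e e0]; first by rewrite s0.
  have [t St lt] := sup_adherent e0 supS.
  exists t; last by case: St.
  by rewrite sup_upper_bound // andbT; case: St => /andP[].
have [<- //|sn1] := eqVneq (sup S) 1.
have s01 : 0 <= sup S < 1 by rewrite s0 lt_neqAle sn1.
have [u /andP[su u1] Tu] := step _ s01 Ts.
have Su : S u by split => //; rewrite u1 andbT ltW // (le_lt_trans s0).
by have := sup_upper_bound supS Su; rewrite leNgt su.
Qed.

End ContinuityMethod.

Section Legendre.
Variables (R : realType) (n : nat).
Local Notation C := R[i].
Local Notation normc := (@Normc.normc R).
Implicit Types (F G : {mpoly C[n]}) (x y z b : 'I_n -> C).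

(** The Legendre transform of [F], up to sign, as a function of the point rather
    than of the gradient. *)
Definition legendre F : {mpoly C[n]} := F - \sum_i F^`M(i) * 'X_i.

Lemma legendreE F z :
  (legendre F).@[z] = F.@[z] - \sum_i (F^`M(i)).@[z] * z i.
Proof.
rewrite /legendre mevalB (raddf_sum (meval z)); congr (_ - _).
by apply: eq_bigr => i _; rewrite [LHS]mevalM mevalXU.
Qed.

(** This is the relation [ds = - <z, db>], where [s] is the Legendre transform
    and [b] the gradient, with a remainder of order two. *)
Lemma legendre_variation G r : 0 <= r -> exists2 K, 0 <= K &
  forall z y d e, in_box r z -> in_box r y -> close_by d z y ->
    (forall i, normc ((G^`M(i)).@[y] - (G^`M(i)).@[z]) <= e) ->
    normc ((legendre G).@[y] - (legendre G).@[z]) <= n%:R * (e * r) + K * d ^+ 2.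
Proof.
move=> r0; have [K K0 hK] := mpoly_taylor G r; exists K => // z y d e zr yr zy ye.
have yz : close_by d y z by move=> i; rewrite normcB_sym.
have -> : (legendre G).@[y] - (legendre G).@[z] =
    - (\sum_i ((G^`M(i)).@[y] - (G^`M(i)).@[z]) * z i)
    - (G.@[z] - G.@[y] - dpoly G y z).
  have E (p q : 'I_n -> C) : \sum_i p i * y i - \sum_i q i * z i =
      \sum_i (p i - q i) * z i - \sum_i (z i - y i) * p i.
    by rewrite -!sumrB; apply: eq_bigr => i _; ring.
  have regroup (a c s t : C) : a - s - (c - t) = a - c - (s - t) by ring.
  rewrite !legendreE regroup (E (fun i => (G^`M(i)).@[y]) (fun i => (G^`M(i)).@[z])).
  by rewrite /dpoly; ring.
apply: normcD_le; rewrite normcN; last exact: hK.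
apply: le_trans (ler_sum_ord (fun=> lexx _)).
by apply: normc_sum_le => i _; exact: normcM_le.
Qed.

(** The gradient is moved along [t |-> b * (1 - t * (1 + i h))], a segment from
    [b] to its multiple by [- i h]. *)
Lemma path_factor_le (t h : R) : 0 <= t <= 1 -> 0 <= h <= 1 ->
  normc (1 - t%:C * (1 +i* h)) <= 1.
Proof.
move=> /andP[t0 t1] /andP[h0 h1].
have -> : 1 - t%:C * (1 +i* h) = (1 - t)%:C + (- t%:C) * (0 +i* h).
  by apply/eqP; rewrite eq_complex /=; apply/andP; split; apply/eqP; ring.
rewrite [leRHS](_ : 1 = (1 - t) + t * 1); last by ring.
apply: normcD_le; first by rewrite normcR ger0_norm // subr_ge0.
apply: normcM_le; first by rewrite normcN normcR ger0_norm.
by rewrite normc_im ger0_norm.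
Qed.

Lemma normc_direction_le (h : R) : 0 <= h <= 1 -> normc (1 +i* h) <= 2.
Proof.
move=> /andP[h0 h1]; apply: le_trans (ler_normc_ReIm _) _.
by rewrite /= normr1 ger0_norm //; lra.
Qed.

(** Continuity method on the set [T] of times [t] reached by some preimage [z] in
    the box for which the Legendre transform has moved by at most [t * L].  The
    bound on the Legendre transform is what makes [T] self-improving: by the
    confinement hypothesis such a [z] is interior to the box, which leaves room
    for local inversion to continue it, and [L] exceeds the rate
    [n * (2 * B * r)] allowed by [legendre_variation] by 1, which absorbs the
    second order term for short steps. *)
Lemma continue_gradient_preimage G x0 (r B h : R) : 0 < r -> 0 <= B -> 0 < h <= 1 ->
  in_box r x0 -> (forall i, normc (G^`M(i)).@[x0] <= B) ->
  (forall z, in_box r z -> (forall i, normc (G^`M(i)).@[z] <= B) ->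
    normc ((legendre G).@[z] - (legendre G).@[x0]) <= n%:R * (2 * B * r) + 1 ->
    forall i, normc (z i) < r) ->
  (forall (t : R) z, 0 <= t <= 1 ->
    (forall i, (G^`M(i)).@[z] = (G^`M(i)).@[x0] * (1 - t%:C * (1 +i* h))) ->
    \det (jacobian_at (fun i => G^`M(i)) z) != 0) ->
  exists2 z, in_box r z &
    forall i, (G^`M(i)).@[z] = (G^`M(i)).@[x0] * (1 - (1 +i* h)).
Proof.
move=> r0 B0 /andP[h0 h1] x0r x0B inner regular.
have h01 : 0 <= h <= 1 by rewrite ltW.
pose N := n%:R : R; have N0 : 0 <= N by rewrite ler0n.
pose L := N * (2 * B * r) + 1.
have L0 : 0 <= N * (2 * B * r) by rewrite mulr_ge0 // mulr_ge0 ?mulr_ge0 // ltW.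
pose b (t : R) i := (G^`M(i)).@[x0] * (1 - t%:C * (1 +i* h)).
have bB t : 0 <= t <= 1 -> forall i, normc (b t i) <= B.
  by move=> t01 i; rewrite -[leRHS]mulr1; apply: normcM_le => //; exact: path_factor_le.
have bt t u e i : `|u - t| <= e -> normc (b u i - b t i) <= 2 * B * e.
  move=> ut; have -> : b u i - b t i = (G^`M(i)).@[x0] * ((1 +i* h) * (t - u)%:C).
    by rewrite /b rmorphB; ring.
  rewrite (_ : 2 * B * e = B * (2 * e)); last by ring.
  apply: normcM_le => //; apply: normcM_le; first exact: normc_direction_le.
  by rewrite normcR distrC.
pose T (t : R) := exists2 z, in_box r z & (forall i, (G^`M(i)).@[z] = b t i) /\
  normc ((legendre G).@[z] - (legendre G).@[x0]) <= t * L.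
have Tin t z : 0 <= t <= 1 -> in_box r z -> (forall i, (G^`M(i)).@[z] = b t i) ->
    normc ((legendre G).@[z] - (legendre G).@[x0]) <= t * L ->
    max_normc z < r.
  move=> t01 zr zb zL; apply: bigmax_lt => // i _; apply: inner => //.
    by move=> j; rewrite zb bB.
  by apply: le_trans zL _; rewrite /L; move: t01 => /andP[t0 t1]; nra.
have [z zr [zb _]] : T 1; last first.
  by exists z => // i; rewrite zb /b mul1r.
apply: continuity_method => [|t /andP[t0 t1] [z zr [zb zL]]|s /andP[s0 s1] near_s].
- exists x0 => //; split=> [i|]; first by rewrite /b mul0r subr0 mulr1.
  by rewrite subrr Normc.normc0 mul0r.
- have t01 : 0 <= t <= 1 by rewrite t0 ltW.
  have [a a0 [d d0 inv]] := local_inversion (regular t z t01 zb).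
  have [K K0 hK] := legendre_variation G (ltW r0).
  have m0 : 0 < r - max_normc z by rewrite subr_gt0; exact: Tin zL.
  set m := r - max_normc z in m0.
  pose D := 2 * B + 1; have D0 : 0 < D by rewrite ltr_wpDl // mulr_ge0.
  pose E := K * (a * D) ^+ 2; have E0 : 0 <= E by rewrite mulr_ge0 // sqr_ge0.
  have aD : 0 <= a * D by rewrite mulr_ge0 // ltW.
  (* The four bounds on the step s keep the time below 1, the gradient within
     the domain of local inversion, the new preimage in the box, and the second
     order term below the slack of 1 in L. *)
  pose s := Num.min (Num.min (1 - t) (d / D)) (Num.min (m / (a * D + 1)) (1 / (E + 1))).
  have s0 : 0 < s by rewrite !lt_min subr_gt0 t1 !divr_gt0 // ltr_wpDl.
  have st : s <= 1 - t by rewrite !ge_min lexx.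
  have sd : s * D <= d by rewrite -ler_pdivlMr // !ge_min lexx !orbT.
  have sm : s * (a * D + 1) <= m.
    by rewrite -ler_pdivlMr ?ltr_wpDl // !ge_min lexx !orbT.
  have sE : s * (E + 1) <= 1.
    by rewrite -ler_pdivlMr ?ltr_wpDl // !ge_min lexx !orbT.
  have sD0 : 0 <= s * D by rewrite mulr_ge0 // ltW.
  have u01 : 0 <= t + s <= 1.
    by rewrite addr_ge0 ?(ltW s0) //=; lra.
  have bs i : normc (b (t + s) i - b t i) <= 2 * B * s.
    by apply: bt; rewrite addrC addKr ger0_norm // ltW.
  have [i|y zy yb] := inv (b (t + s)) (s * D) sD0 sd.
    rewrite zb; apply: le_trans (bs i) _.
    by rewrite [leRHS]mulrC ler_wpM2r ?(ltW s0) // lerDl.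
  have yr : in_box r y.
    move=> i; rewrite -(subrK (z i) (y i)).
    have -> : r = m + max_normc z by rewrite /m subrK.
    apply: normcD_le; last exact: le_max_normc.
    by apply: le_trans (zy i) _; apply: le_trans sm; move: s0; nra.
  exists (t + s); first by rewrite ltrDl s0; case/andP: u01.
  exists y => //; split => //.
  rewrite -(subrK (legendre G).@[z] (legendre G).@[y]) -addrA mulrDl addrC.
  apply: normcD_le => //.
  apply: le_trans (hK z y (a * (s * D)) (2 * B * s) zr yr zy _) _.
    by move=> i; rewrite yb zb.
  rewrite (_ : K * _ = s * s * E); last by rewrite /E; ring.
  rewrite -/N (_ : s * L = N * (2 * B * s * r) + s); last by rewrite /L; ring.
  by rewrite lerD2l; move: s0 E0 sE; nra.
- (* The zeros of phi in the box are the preimages that put s in T. *)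
  pose phi z := \sum_i normc ((G^`M(i)).@[z] - b s i) +
    Num.max 0 (normc ((legendre G).@[z] - (legendre G).@[x0]) - s * L).
  have phil : lipschitz_on_box r phi.
    apply: lipschitz_on_boxD.
      by apply: lipschitz_on_box_sum => i; exact: lipschitz_on_box_normc.
    apply: (@lipschitz_on_box_comp _ _ _ (fun u => Num.max 0 (u - s * L))).
      move=> u v; rewrite ler_norml.
      have := ler_norm (u - v); have := ler_norm (v - u); rewrite [`|v - u|]distrC.
      by rewrite !maxElt; case: ltP => ?; case: ltP => ? ? ?; apply/andP; split; lra.
    exact: lipschitz_on_box_normc.
  have phi1 z : 0 <= \sum_i normc ((G^`M(i)).@[z] - b s i).
    by apply: sumr_ge0 => i _; exact: normc_ge0.
  have phi2 z : 0 <= Num.max 0 (normc ((legendre G).@[z] - (legendre G).@[x0]) - s * L).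
    by rewrite le_max lexx.
  have [z|e e0|z zr] := box_zero (ltW r0) phil.
  + exact: addr_ge0.
  + pose D := N * (2 * B) + 1.
    have D0 : 0 < D by rewrite ltr_wpDl // mulr_ge0 // mulr_ge0.
    have [t /andP[t0 ts] [st [z zr [zb zL]]]] := near_s (e / D) (divr_gt0 e0 D0).
    exists z => //; rewrite /phi [X in _ + X]max_l ?addr0.
      have : s - t <= e / D by lra.
      rewrite ler_pdivlMr // => stD.
      apply: (@le_trans _ _ (N * (2 * B * (s - t)))).
        apply: ler_sum_ord => i; rewrite zb; apply: bt.
        by rewrite distrC ger0_norm // subr_ge0.
      by apply: le_trans stD; rewrite /D; nra.
    rewrite subr_le0; apply: le_trans zL _; rewrite ler_wpM2r //.
    by rewrite /L addr_ge0.
  + move/eqP; rewrite paddr_eq0 // => /andP[z1 z2]; exists z => //; split => [i|].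
      apply/eqP; rewrite -subr_eq0 -normc_eq0.
      move: z1; rewrite psumr_eq0 => [|j _]; last exact: normc_ge0.
      by move=> /allP/(_ i (mem_index_enum i)).
    by rewrite -subr_le0; move/eqP: z2 => <-; rewrite le_max lexx orbT.
Qed.

End Legendre.

(** * Existence of critical points under confinement *)

Section CriticalPoint.
Variables (R : realType) (n : nat).
Local Notation C := R[i].
Local Notation normc := (@Normc.normc R).
Implicit Types (F G : {mpoly C[n]}) (x y z b : 'I_n -> C).

(** A perturbation that shifts the Hessian matrix by [a] times the identity. *)
Definition add_squares F (a : C) : {mpoly C[n]} := F + (a / 2) *: \sum_i 'X_i ^+ 2.

Lemma mderiv_add_squares F a i : (add_squares F a)^`M(i) = F^`M(i) + a *: 'X_i.
Proof.
rewrite mderivD mderivZ (linear_sum (@mderiv _ _ i)) (bigD1 i) //= big1 => [|j ji];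
  last first.
  by rewrite /= expr2 mderivM mderiv_var eq_sym (negbTE ji) mul0r mulr0 addr0.
rewrite /= expr2 mderivM mderiv_var eqxx mul1r mulr1 addr0.
by rewrite scalerDr -scalerDl -splitr.
Qed.

Lemma legendre_add_squares F a z :
  (legendre F).@[z] = (legendre (add_squares F a)).@[z] + a / 2 * \sum_i z i ^+ 2.
Proof.
have valE : (add_squares F a).@[z] = F.@[z] + a / 2 * \sum_i z i ^+ 2.
  rewrite /add_squares (mevalD z) (mevalZ z) (raddf_sum (meval z)).
  by congr (_ + _ * _); apply: eq_bigr => i _; rewrite !expr2 [LHS]mevalM mevalXU.
have gradE : \sum_i ((add_squares F a)^`M(i)).@[z] * z i =
    \sum_i (F^`M(i)).@[z] * z i + a * \sum_i z i ^+ 2.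
  rewrite mulr_sumr -big_split; apply: eq_bigr => i _ /=.
  by rewrite mderiv_add_squares (mevalD z) (mevalZ z) mevalXU mulrDl expr2 mulrA.
rewrite [LHS]legendreE [X in _ = X + _]legendreE valE gradE.
set s := F.@[z]; set t := \sum_i (_ * _); set u := \sum_i _.
by move: s t u => s t u; field.
Qed.

(** The image of the unit box under [G] contains a ball, on which [Q] cannot
    vanish identically. *)
Lemma regular_start (G : 'I_n -> {mpoly C[n]}) :
  \det (jacobian_at G (fun=> 0)) != 0 ->
  exists2 Q : {mpoly C[n]}, (exists2 x0, in_box 1 x0 & Q.@[fun i => (G i).@[x0]] != 0) &
    forall z, Q.@[fun i => (G i).@[z]] != 0 -> \det (jacobian_at G z) != 0.
Proof.
move=> J0; have [a a0 [d d0 inv]] := local_inversion J0.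
have [|Q Q0 QJ] := @image_of_hypersurface _ _ G (\det (jacobian G)).
  by apply: contraNneq J0 => J0; rewrite det_jacobian_at J0 meval0.
exists Q => [|z]; last first.
  by apply: contra_neq => Jz; apply: QJ; rewrite -det_jacobian_at.
pose e := Num.min d (1 / (a + 1)).
have e0 : 0 < e by rewrite lt_min d0 divr_gt0 // ltr_wpDl.
have ed : e <= d by rewrite ge_min lexx.
have ea : e * (a + 1) <= 1 by rewrite -ler_pdivlMr ?ltr_wpDl // ge_min lexx orbT.
apply: contrapT => none; move/eqP: Q0; apply.
apply: (@mpoly_vanish_box _ _ _ (fun i => (G i).@[fun=> 0]) e) => // b eb.
have [x xe Gx] := inv b e (ltW e0) ed eb.
apply: contrapT => /eqP Qb; apply: none; exists x.
  move=> i; have := xe i; rewrite subr0 => /le_trans; apply.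
  by move: ea; nra.
by rewrite (_ : (fun i => _) = b) //; apply/funext.
Qed.

(** The hypothesis says that, whatever the bound on the gradient, some box has
    the property that its points whose Legendre transform is at most linear in
    its radius lie in its interior.  It is applied with constants slightly
    larger than those of [F] on the unit box, so that the radius can be chosen
    before the perturbation [x] and the slope [h] of the path, both of which
    then tend to 0. *)
Theorem critical_point_exists F :
  (forall A B, 0 <= A -> 0 <= B -> exists2 r, 1 <= r & forall y, in_box r y ->
    (forall i, normc (F^`M(i)).@[y] <= B) ->
    normc (legendre F).@[y] <= A + B * r -> forall i, normc (y i) < r) ->
  exists y, forall i, (F^`M(i)).@[y] = 0.
Proof.
move=> confined.
have [B1 B10 hB1] : exists2 K, 0 <= K & forall i x, in_box 1 x -> normc
  (F^`M(i)).@[x] <= K.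
  apply: fin_uniform_bound => [i K K' KK' h x x1|i]; last exact: mpoly_bounded.
  exact: le_trans (h x x1) KK'.
have [A1 A10 hA1] := mpoly_bounded (legendre F) 1.
pose N := n%:R : R; have N0 : 0 <= N by rewrite ler0n.
pose B2 := B1 + 1; have B20 : 0 <= B2 by rewrite addr_ge0.
have A0 : 0 <= A1 + 3 by exact: addr_ge0.
have B0 : 0 <= B2 + 1 + 2 * N * B2 by rewrite !addr_ge0 // mulr_ge0 // mulr_ge0.
(* The 3 consists of the slack 1 in the variation along the path and of the
   effect of the perturbation on the Legendre transform, at most 1 at the start
   and at most 1 at the end. *)
have [r r1 hr] := confined _ _ A0 B0.
have r0 : 0 < r := lt_le_trans ltr01 r1.
pose phi z := \sum_i normc ((F^`M(i)).@[z] - 0).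
have phil : lipschitz_on_box r phi.
  by apply: lipschitz_on_box_sum => i; exact: lipschitz_on_box_normc.
have [z|e e0|y yr] := box_zero (ltW r0) phil.
- by apply: sumr_ge0 => i _; exact: normc_ge0.
- pose S := N * r ^+ 2 + 2 * (N * r) + r + 1.
  have S0 : 0 < S by rewrite ltr_wpDl // !addr_ge0 // ?mulr_ge0 ?sqr_ge0 //
    ?mulr_ge0 // ltW.
  pose h := Num.min 1 (e / (2 * (N * B2 + 1))).
  have h0 : 0 < h by rewrite lt_min ltr01 divr_gt0 // mulr_gt0 // ltr_wpDl // mulr_ge0.
  have h1 : h <= 1 by rewrite ge_min lexx.
  have he : h * (2 * (N * B2 + 1)) <= e.
    by rewrite -ler_pdivlMr ?ge_min ?lexx ?orbT // mulr_gt0 // ltr_wpDl // mulr_ge0.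
  have c0 : 0 < Num.min 1 e / S by rewrite divr_gt0 // lt_min ltr01.
  have [x /andP[x0 xS] Jx] := small_det_shift (jacobian_at (fun i => F^`M(i))
    (fun=> 0)) c0.
  have {c0} [xS1 xSe] : x * S <= 1 /\ x * S <= e.
    by split; rewrite -ler_pdivlMr //; apply: le_trans xS _;
      rewrite ler_pM2r ?invr_gt0 // ge_min lexx ?orbT.
  have Nr : 0 <= N * r by rewrite mulr_ge0 // ltW.
  have Nr2 : 0 <= N * r ^+ 2 by rewrite mulr_ge0 // sqr_ge0.
  have xr1 : x * r <= 1 by move: xS1; rewrite /S; nra.
  have xNr2 : x * (N * r ^+ 2) <= 1 by move: xS1; rewrite /S; nra.
  have xNre : x * (2 * (N * r)) <= e by move: xSe; rewrite /S; nra.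
  pose G := add_squares F x%:C.
  have GE i z : (G^`M(i)).@[z] = (F^`M(i)).@[z] + x%:C * z i.
    by rewrite mderiv_add_squares mevalD mevalZ mevalXU.
  have legE s z : in_box s z ->
      normc ((legendre F).@[z] - (legendre G).@[z]) <= x * (N * s ^+ 2).
    move=> zs; rewrite [X in normc (X - _)](legendre_add_squares F x%:C) addrC addKr.
    apply: normcM_le.
      rewrite (_ : x%:C / 2 = (x / 2)%:C) ?normcR ?ger0_norm ?divr_ge0 ?(ltW x0)
        //; first by lra.
      by rewrite rmorphM fmorphV rmorph_nat.
    apply: le_trans (ler_sum_ord (fun=> lexx _)).
    by apply: normc_sum_le => i _; rewrite !expr2; exact: normcM_le.
  have JG : \det (jacobian_at (fun i => G^`M(i)) (fun=> 0)) != 0.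
    rewrite (_ : jacobian_at _ _ =
      jacobian_at (fun i => F^`M(i)) (fun=> 0) + x%:C%:M) //.
    apply/matrixP => i j; rewrite !mxE mderiv_add_squares mderivD mderivZ mderiv_var.
    by rewrite mevalD mevalZ rmorph_nat eq_sym; case: eqP; rewrite ?mulr1 ?mulr0.
  have [Q [x0' x01 Qx0] QJ] := regular_start JG.
  have [q qE] := poly_along_line Q (fun i => (G^`M(i)).@[x0']).
  have q0 : q.[0] != 0.
    rewrite qE (_ : (fun i => _) = fun i => (G^`M(i)).@[x0']) //.
    by apply/funext => i; rewrite subr0 mulr1.
  have [h' /andP[h'0 h'h] hq] := ray_avoiding_roots q0 h0.
  have G1 i : normc (G^`M(i)).@[x0'] <= B2.
    rewrite GE; apply: normcD_le; first exact: hB1.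
    rewrite -[leRHS]mulr1; apply: normcM_le => //.
    by rewrite normcR ger0_norm ?(ltW x0) //; move: xr1; nra.
  have [||||| z zr] := continue_gradient_preimage (G := G) (x0 := x0') (h := h') r0 B20.
  + by rewrite h'0 (le_trans h'h).
  + by move=> i; exact: le_trans (x01 i) r1.
  + exact: G1.
  + move=> z zr zG legz; apply: hr => //.
      move=> i; rewrite -[_.@[_]](addrK (x%:C * z i)) -GE.
      apply: (@le_trans _ _ (B2 + 1)).
        apply: normcD_le => //; rewrite normcN; apply: le_trans xr1.
        by apply: normcM_le => //; rewrite normcR ger0_norm // ltW.
      by rewrite lerDl mulr_ge0 // mulr_ge0.
    rewrite -[_.@[_]](subrK (legendre G).@[z]).
    rewrite -[(legendre G).@[z] in X in _ + X](subrK (legendre G).@[x0']).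
    rewrite -[(legendre G).@[x0'] in X in _ + (_ + X)](subrK (legendre F).@[x0']).
    have := hA1 x0' x01; have := legE 1 x0' x01; rewrite normcB_sym expr1n => l1 l2.
    have x1 : x * (N * 1) <= 1 by apply: le_trans xNr2;
      rewrite ler_wpM2l ?(ltW x0) // ler_wpM2l // -[leLHS](expr1n _ 2) lerXn2r ?nnegrE // ltW.
    apply: (@le_trans _ _ (1 + ((N * (2 * B2 * r) + 1) + (1 + A1)))).
      apply: normcD_le; first exact: le_trans (legE r z zr) xNr2.
      apply: normcD_le => //; apply: normcD_le => //; exact: le_trans l1 x1.
    rewrite [leRHS](_ : _ = 1 + (N * (2 * B2 * r) + 1 + (1 + A1)) + (B2 * r + r)).
      by rewrite lerDl addr_ge0 ?mulr_ge0 // ltW.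
    by ring.
  + move=> t y _ yG; apply: QJ.
    rewrite (_ : (fun i => _) = fun i => (G^`M(i)).@[x0'] * (1 - t%:C * (1 +i* h'))).
      by rewrite -qE; exact: hq.
    exact/funext.
  move=> zG; exists z => //; rewrite /phi.
  apply: (@le_trans _ _ (N * (B2 * h + x * r))).
    apply: ler_sum_ord => i; rewrite subr0 -[_.@[_]](addrK (x%:C * z i)) -GE zG.
    apply: normcD_le; last first.
      by rewrite normcN; apply: normcM_le => //; rewrite normcR ger0_norm // ltW.
    apply: normcM_le => //.
    rewrite (_ : 1 - _ = - (0 +i* h')); last by apply/eqP;
      rewrite eq_complex /= subrr oppr0 add0r !eqxx.
    by rewrite normcN normc_im ger0_norm // ltW.
  by move: he xNre; rewrite mulrDr; nra.
- move/eqP; rewrite psumr_eq0 => [/allP y0|j _]; last exact: normc_ge0.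
  exists y => i; apply/eqP; rewrite -normc_eq0 -[_.@[y]]subr0.
  exact: y0 (mem_index_enum i).
Qed.

End CriticalPoint.

(** * Weighted homogeneous polynomials *)

Section WeightedHomogeneous.
Variables (K : numFieldType) (n : nat) (w : n.-tuple nat).
Implicit Types (f : {mpoly K[n]}) (x : 'I_n -> K).

Lemma dhomog_mderiv d f i : f \is d.-homog for (wdeg w) ->
  f^`M(i) \is (d - tnth w i).-homog for (wdeg w).
Proof.
move=> /dhomogP hf; apply/dhomogP => m mf.
have /hf : (m + U_(i))%MM \in msupp f.
  move: mf; rewrite !mcoeff_msupp mcoeff_mderiv mulrn_eq0 /=; exact.
have wU : wdeg w U_(i) = tnth w i.
  rewrite /wdeg (bigD1 i) //= mnm1E eqxx mul1n big1 ?addn0 // => j ji.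
  by rewrite mnm1E eq_sym (negbTE ji).
by move=> h; rewrite (etrans (esym h) (wdegD w m U_(i)%MM)) wU addnK.
Qed.

Lemma dhomog_scale d f (s : K) x : f \is d.-homog for (wdeg w) ->
  f.@[fun i => s ^+ tnth w i * x i] = s ^+ d * f.@[x].
Proof.
move=> /dhomogP hf; rewrite !mevalE mulr_sumr; apply: eq_big_seq => m /hf <-.
rewrite mulrCA /wdeg; congr (_ * _).
rewrite (eq_bigr (fun i => s ^+ (m i * tnth w i) * x i ^+ m i)) => [|i _].
  by rewrite big_split prodrXr.
by rewrite exprMn -exprM mulnC.
Qed.

Lemma euler_identity d f x : f \is d.-homog for (wdeg w) ->
  \sum_i (tnth w i)%:R * ((f^`M(i)).@[x] * x i) = d%:R * f.@[x].
Proof.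
move=> /dhomogP hf.
have dX i m : ('X_[K, m]^`M(i)).@[x] * x i = (m i)%:R * ('X_[m]).@[x].
  rewrite mderivX mevalZ -mulrA; have [->|mi] := eqVneq (m i) 0%N;
    first by rewrite !mul0r.
  congr (_ * _); rewrite -[X in _ * X](mevalXU x i) -[LHS]mevalM -mpolyXD submK //.
  by apply/mnm_lepP => j; rewrite mnm1E; case: eqP => [<-|//]; rewrite lt0n.
have df i : (f^`M(i)).@[x] * x i =
    \sum_(m <- msupp f) f@_m * ((m i)%:R * ('X_[m]).@[x]).
  rewrite [in LHS](mpolyE f) (linear_sum (@mderiv _ _ i)) (raddf_sum (meval x))
    mulr_suml.
  by apply: eq_bigr => m _; rewrite /= mderivZ mevalZ -mulrA dX.
under eq_bigr do rewrite df mulr_sumr.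
rewrite exchange_big [in RHS](mpolyE f) (raddf_sum (meval x)) mulr_sumr /=.
apply: eq_big_seq => m /hf <-; rewrite mevalZ /wdeg natr_sum mulr_suml.
by apply: eq_bigr => i _; rewrite natrM; ring.
Qed.

End WeightedHomogeneous.

Section QuasiNorm.
Variables (R : realType) (n : nat) (w : n.-tuple nat).
Hypothesis w_gt0 : forall i, (0 < tnth w i)%N.
Local Notation C := R[i].
Local Notation normc := (@Normc.normc R).

Lemma quasi_norm_exists (z : 'I_n -> C) : (exists i, z i != 0) ->
  exists2 t : R, 0 < t & (forall i, normc (z i) <= t ^+ tnth w i) /\
    exists i, normc (z i) = t ^+ tnth w i.
Proof.
move=> [k zk]; pose rho i := normc (z i) `^ (tnth w i)%:R^-1.
have rhoX i : rho i ^+ tnth w i = normc (z i).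
  rewrite -powR_mulrn ?powR_ge0 // -powRrM mulVf ?powRr1 ?normc_ge0 //.
  by rewrite pnatr_eq0 -lt0n.
have rho0 i : 0 <= rho i by exact: powR_ge0.
have [i _ imax] := @arg_maxP _ _ _ k xpredT rho isT.
exists (rho i).
  apply: lt_le_trans (imax k isT); rewrite lt_def rho0 andbT.
  apply: contra zk => /eqP rk; rewrite -normc_eq0 -rhoX rk expr0n.
  by rewrite (gtn_eqF (w_gt0 k)).
split; last by exists i; rewrite rhoX.
by move=> j; rewrite -rhoX lerXn2r ?nnegrE //; exact: imax.
Qed.

(** The point [z] is scaled to a point [x] of the unit polydisc with a coordinate
    of modulus 1, where compactness bounds the gradient from below.  To stay
    within minimisation over a box, the constraint on the modulus of the
    coordinate [k] enters as a penalty in [phi]. *)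
Lemma quasi_norm_ge (d : nat) (f : {mpoly C[n]}) :
  f \is d.-homog for (wdeg w) ->
  (forall x, (forall i, (f^`M(i)).@[x] = 0) -> forall i, x i = 0) ->
  exists2 c, 0 < c & forall (t : R) z, 0 < t ->
    (forall i, normc (z i) <= t ^+ tnth w i) ->
    (exists i, normc (z i) = t ^+ tnth w i) ->
    exists i, c * t ^+ (d - tnth w i) <= normc (f^`M(i)).@[z].
Proof.
move=> hf iso.
pose S x := \sum_i normc ((f^`M(i)).@[x] - 0).
have S0 x : 0 <= S x by apply: sumr_ge0 => i _; exact: normc_ge0.
have [K K0 hK] : exists2 K, 0 <= K & forall k x, in_box 1 x -> normc (x k) = 1 ->
    1 <= K * S x.
  apply: fin_uniform_bound => [k K K' KK' h x x1 xk|k].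
    by apply: le_trans (h x x1 xk) _; rewrite ler_wpM2r.
  pose phi x := S x + `|1 - normc (('X_k : {mpoly C[n]}).@[x] - 0)|.
  have phil : lipschitz_on_box 1 phi.
    apply: lipschitz_on_boxD.
      by apply: lipschitz_on_box_sum => i; exact: lipschitz_on_box_normc.
    apply: (@lipschitz_on_box_comp _ _ _ (fun u => `|1 - u|));
      last exact: lipschitz_on_box_normc.
    move=> u v; apply: le_trans (ler_dist_dist _ _) _.
    have -> : 1 - u - (1 - v) = v - u by lra.
    by rewrite distrC.
  have [x x1 xmin] := box_min ler01 phil.
  have phix : 0 < phi x.
    rewrite lt_def addr_ge0 // andbT paddr_eq0 //.
    apply/negP => /andP[Sx]; rewrite mevalXU.
    rewrite (iso x) ?subrr ?Normc.normc0 ?subr0 ?normr1 ?oner_eq0 // => i.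
    apply/eqP; rewrite -normc_eq0 -[_.@[_]]subr0.
    move: Sx; rewrite psumr_eq0 => [|j _]; last exact: normc_ge0.
    by move=> /allP/(_ i (mem_index_enum i)).
  exists (phi x)^-1 => [|y y1 yk]; first by rewrite invr_ge0 ltW.
  rewrite mulrC ler_pdivlMr // mul1r; apply: le_trans (xmin y y1) _.
  by rewrite /phi mevalXU subr0 yk subrr normr0 addr0.
pose N := n%:R : R; have N0 : 0 <= N by rewrite ler0n.
have NK : 0 <= N * K by rewrite mulr_ge0.
exists (N * K + 1)^-1 => [|t z t0 zt [k zk]]; first by rewrite invr_gt0 ltr_wpDl.
have tX0 j : t ^+ j != 0 by rewrite expf_neq0 // gt_eqF.
pose x i := (t ^+ tnth w i)^-1%:C * z i.
have nx i : normc (x i) = (t ^+ tnth w i)^-1 * normc (z i).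
  by rewrite Normc.normcM normcR ger0_norm // invr_ge0 exprn_ge0 // ltW.
have x1 : in_box 1 x.
  by move=> i; rewrite nx mulrC ler_pdivrMr ?exprn_gt0 // mul1r.
have xk : normc (x k) = 1 by rewrite nx zk mulVf.
have zE : z = fun i => t%:C ^+ tnth w i * x i.
  apply/funext => i; rewrite /x mulrA -rmorphXn -rmorphM mulfV // rmorph1.
  by rewrite mul1r.
have fz i : normc (f^`M(i)).@[z] = t ^+ (d - tnth w i) * normc (f^`M(i)).@[x].
  rewrite zE (dhomog_scale _ _ (dhomog_mderiv i hf)) Normc.normcM normcX normcR.
  by rewrite ger0_norm // ltW.
apply: contrapT => none.
have small i : normc ((f^`M(i)).@[x] - 0) <= (N * K + 1)^-1.
  rewrite subr0 leNgt; apply/negP => h; apply: none; exists i.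
  by rewrite fz mulrC ler_pM2l ?exprn_gt0 // ltW.
have : S x <= N * (N * K + 1)^-1.
  exact: ler_sum_ord.
move=> /(ler_wpM2l K0) /(le_trans (hK k x x1 xk)).
rewrite mulrA ler_pdivlMr ?ltr_wpDl //; rewrite mul1r mulrC; lra.
Qed.

End QuasiNorm.

(** * A point on the polar variety *)

Section AffineChart.
Variables (K : fieldType) (n : nat) (i0 : 'I_n.+1).

Definition chart_point (y : 'I_n -> K) (i : 'I_n.+1) : K :=
  if unlift i0 i is Some j then y j else 1.

Definition chart : n.+1.-tuple {mpoly K[n]} :=
  [tuple if unlift i0 i is Some j then 'X_j else 1 | i < n.+1].

Definition dehomogenize (f : {mpoly K[n.+1]}) : {mpoly K[n]} := f \mPo chart.

Lemma chart_point0 y : chart_point y i0 = 1.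
Proof. by rewrite /chart_point unlift_none. Qed.

Lemma chart_point_lift y j : chart_point y (lift i0 j) = y j.
Proof. by rewrite /chart_point liftK. Qed.

Lemma meval_dehomogenize f y : (dehomogenize f).@[y] = f.@[chart_point y].
Proof.
rewrite comp_mpoly_meval; apply: meval_eq => i; rewrite tnth_mktuple /chart_point.
by case: unlift => [j|]; rewrite ?mevalXU ?meval1.
Qed.

Lemma mderiv_dehomogenize f j :
  (dehomogenize f)^`M(j) = dehomogenize f^`M(lift i0 j).
Proof.
rewrite /dehomogenize; elim/mpoly_ring_ind: f => [c|i|p q IHp IHq|p q IHp IHq].
- by rewrite comp_mpolyC !mderivC comp_mpoly0.
- rewrite comp_mpolyXU -tnth_nth tnth_mktuple mderiv_var.
  case: unliftP => [k|] ->; first by rewrite mderiv_var (inj_eq lift_inj) rmorph_nat.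
  by rewrite -mpolyC1 mderivC eq_sym (negbTE (neq_lift _ _)) rmorph0.
- by rewrite !mderivD !comp_mpolyD mderivD IHp IHq.
- by rewrite !mderivM rmorphD !rmorphM mderivM /= IHp IHq.
Qed.

End AffineChart.

Section PolarPoint.
Variables (R : realType).
Local Notation C := R[i].
Local Notation normc := (@Normc.normc R).

(** Let [t] be the quasi-norm of [z = (1, y)] and suppose that a coordinate of
    [y] has modulus at least [r], so that [r <= t ^ W], where [W] bounds all the
    weights.  If the index provided by [quasi_norm_ge] is not [i0], the bound on
    the gradient of [F] bounds [t].  Otherwise Euler's identity gives
    [c * t ^ W.+1 <= E * t ^ W], which also bounds [t].  The radius is chosen
    larger than the resulting bound on [t ^ W]. *)
Lemma dehomogenize_confined n (w : n.+1.-tuple nat) d (f : {mpoly C[n.+1]}) i0 :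
  (forall i, (0 < tnth w i)%N) -> (forall i, (tnth w i0 + tnth w i < d)%N) ->
  f \is d.-homog for (wdeg w) ->
  (forall x, (forall i, (f^`M(i)).@[x] = 0) -> forall i, x i = 0) ->
  let F := dehomogenize i0 f in
  forall A B, 0 <= A -> 0 <= B -> exists2 r, 1 <= r & forall y, in_box r y ->
    (forall i, normc (F^`M(i)).@[y] <= B) ->
    normc (legendre F).@[y] <= A + B * r -> forall i, normc (y i) < r.
Proof.
move=> w0 wd hf iso F A B A0 B0.
have [c c0 hc] := quasi_norm_ge hf iso.
pose N := n%:R : R; have N0 : 0 <= N by rewrite ler0n.
pose D := d%:R : R; have D0 : 0 <= D by rewrite ler0n.
have w_lt_d i : (tnth w i < d)%N := leq_ltn_trans (leq_addl _ _) (wd i).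
pose W := (d - tnth w i0).-1.
have wW i : (tnth w i <= W)%N by rewrite /W; have := wd i; lia.
have dW : (d - tnth w i0 = W.+1)%N by rewrite /W; have := wd i0; lia.
pose E := D * (A + B + N * B).
have E0 : 0 <= E by rewrite mulr_ge0 // addr_ge0 ?addr_ge0 // mulr_ge0.
pose M := 1 + B / c + E / c.
have Bc : 0 <= B / c by rewrite divr_ge0 // ltW.
have Ec : 0 <= E / c by rewrite divr_ge0 // ltW.
have M1 : 1 <= M by rewrite /M -addrA lerDl addr_ge0.
exists (M ^+ W + 1); set r := M ^+ W + 1.
  by rewrite lerDr exprn_ge0 // (le_trans ler01).
move=> y _ yB yL j; rewrite ltNge; apply/negP => ry.
pose z := chart_point i0 y.
have z0 : z i0 = 1 := chart_point0 i0 y.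
have Fz k : (F^`M(k)).@[y] = (f^`M(lift i0 k)).@[z].
  by rewrite mderiv_dehomogenize meval_dehomogenize.
have [|t t0 [zt tz]] := quasi_norm_exists w0 (z := z).
  by exists i0; rewrite z0 oner_eq0.
have t1 : 1 <= t.
  have := zt i0; rewrite z0 Normc.normc1 leNgt => /negP h; rewrite leNgt;
    apply/negP => tl.
  by apply: h; rewrite exprn_ilt1 ?ltW // -lt0n.
have yt k : normc (y k) <= t ^+ W.
  have := zt (lift i0 k); rewrite /z chart_point_lift => /le_trans; apply.
  exact: ler_weXn2l.
have tW : 1 <= t ^+ W by exact: exprn_ege1.
(* A bound on t contradicts r <= t ^ W, by the choice of r. *)
suff tM : t <= M.
  have : t ^+ W <= M ^+ W by rewrite lerXn2r ?nnegrE // ltW // (lt_le_trans ltr01).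
  by have := yt j; have := ry; rewrite /r; lra.
have [l] := hc t z t0 zt tz; case: (unliftP i0 l) => [k|] ->.
  rewrite -Fz => /le_trans/(_ (yB k)) h.
  have : c * t <= B.
    apply: le_trans h; rewrite ler_pM2l // -[leLHS]expr1 ler_weXn2l //.
    by rewrite subn_gt0.
  by rewrite mulrC -ler_pdivlMr // => h'; apply: le_trans h' _; rewrite /M; lra.
rewrite dW => ct.
have euler : (tnth w i0)%:R * (f^`M(i0)).@[z] = d%:R * (legendre F).@[y]
    + \sum_k (d - tnth w (lift i0 k))%:R * ((F^`M(k)).@[y] * y k).
  have := euler_identity z hf; rewrite (bigD1_ord i0) //= z0 mulr1.
  under eq_bigr do rewrite -Fz /z chart_point_lift.
  have -> : \sum_k (d - tnth w (lift i0 k))%:R * ((F^`M(k)).@[y] * y k) =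
      d%:R * (\sum_k (F^`M(k)).@[y] * y k)
      - \sum_k (tnth w (lift i0 k))%:R * ((F^`M(k)).@[y] * y k).
    rewrite mulr_sumr -sumrB; apply: eq_bigr => k _.
    by rewrite natrB ?mulrBl // ltnW.
  rewrite [X in _ -> _ = _ * X + _]legendreE meval_dehomogenize -/z => eul.
  rewrite mulrBr -eul; set U := \sum_k _; set V := d%:R * _.
  by move: U V => U V; ring.
have normc_nat k : normc k%:R = k%:R :> R.
  by rewrite -[k%:R](rmorph_nat (real_complex R)) normcR ger0_norm // ler0n.
have f0le : normc (f^`M(i0)).@[z] <= D * (A + B * r) + N * (D * (B * t ^+ W)).
  apply: (@le_trans _ _ (normc ((tnth w i0)%:R * (f^`M(i0)).@[z]))).
    by rewrite Normc.normcM normc_nat ler_peMl ?normc_ge0 // ler1n.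
  rewrite euler; apply: normcD_le.
    by apply: normcM_le; rewrite ?normc_nat.
  apply: le_trans (ler_sum_ord (fun=> lexx _)); apply: normc_sum_le => k _.
  apply: normcM_le; last exact: normcM_le.
  by rewrite normc_nat ler_nat leq_subr.
have rt : r <= t ^+ W := le_trans ry (yt j).
have : c * t ^+ W.+1 <= E * t ^+ W.
  apply: le_trans ct (le_trans f0le _).
  rewrite /E [leRHS](_ : _ = D * (A * t ^+ W + B * t ^+ W) + N * (D * (B * t ^+
    W))); last by ring.
  rewrite lerD2r ler_wpM2l // lerD ?ler_wpM2l //.
  by rewrite ler_peMr.
rewrite exprS mulrA ler_pM2r ?(lt_le_trans ltr01) // mulrC -ler_pdivlMr // => h.
by apply: le_trans h _; rewrite /M; lra.
Qed.

(** Setting the coordinate [i0] to 1 makes all the other derivatives of [f] the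
    gradient of the dehomogenized polynomial.  The hypothesis of confinement
    holds as soon as some weight exceeds the smallest one: then
    [d >= 2 * w_k > w_{i0} + w_i] when [w_i = w_{i0}], and
    [d >= 2 * w_i > w_{i0} + w_i] otherwise. *)
Theorem polar_point_exists n (w : n.-tuple nat) d (f : {mpoly C[n]}) i0 :
  (forall i, (0 < tnth w i)%N) -> (forall i, (2 * tnth w i <= d)%N) ->
  (forall i, (tnth w i0 <= tnth w i)%N) ->
  f \is d.-homog for (wdeg w) ->
  (forall x, (forall i, (f^`M(i)).@[x] = 0) -> forall i, x i = 0) ->
  exists2 x : 'I_n -> C, x i0 = 1 &
    forall i, (tnth w i0 < tnth w i)%N -> (f^`M(i)).@[x] = 0.
Proof.
case: n w f i0 => [? ? []//|n] w f i0 w0 wd wmin hf iso.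
have [/existsP[k wk]|] := boolP [exists k, tnth w i0 < tnth w k]%N; last first.
  rewrite negb_exists => /forallP wle; exists (fun=> 1) => // i wi.
  by have := wle i; rewrite wi.
have [i|y y0] := critical_point_exists (dehomogenize_confined w0 _ hf iso (i0 := i0)).
  by have := wd i; have := wd k; have := wmin i; lia.
exists (chart_point i0 y); first exact: chart_point0.
move=> i; case: (unliftP i0 i) => [j ->|->]; last by rewrite ltnn.
by move=> _; rewrite -meval_dehomogenize -mderiv_dehomogenize y0.
Qed.

End PolarPoint.

(** * The gradient and neighbourhoods of the origin *)

Section Topology.
Variables (R : realType) (n : nat).
Local Notation C := (R[i]^o).
Local Notation normc := (@Normc.normc R).

Lemma near0_normcP (P : 'rV[C]_n -> Prop) :
  (\forall z \near (0 : 'rV[C]_n), P z) <->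
  exists2 d : R, 0 < d &
    forall z : 'rV[C]_n, (forall i, normc (z ord0 i) < d) -> P z.
Proof.
split.
  move=> /nbhs_ballP[e /= e0 he]; case: e e0 he => a b;
    rewrite ltcE /= => /andP[/eqP-> a0] he.
  exists a => // z zd; apply: he; split; first by rewrite ltcR.
  move=> i j; rewrite (ord1 i) mxE /ball /= sub0r normrN normr_normc ltcR; exact: zd.
move=> [d d0 hd]; apply/nbhs_ballP; exists d%:C => /=; first by rewrite ltcR.
move=> z [_ zd]; apply: hd => i.
by have := zd ord0 i; rewrite mxE /ball /= sub0r normrN normr_normc ltcR.
Qed.

Lemma grad_mpolyE (f : {mpoly R[i][n]}) (z : 'rV[C]_n) :
  grad (mpoly_fun f) z = \row_i (f^`M(i)).@[z ord0].
Proof.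
apply/rowP => i; rewrite !mxE /derive; apply: cvg_lim => //.
pose r := \sum_j normc (z ord0 j) + 1.
have [K K0 hK] := mpoly_taylor f r.
apply/cvgrPdist_le => -[a b]; rewrite ltcE /= => /andP[/eqP-> a0].
apply/nbhs_ballP; exists (Num.min 1 (a / (K + 1)))%:C => /=.
  by rewrite ltcR lt_min ltr01 divr_gt0 // ltr_wpDl.
move=> h; rewrite /ball /= sub0r normrN normr_normc ltcR lt_min => /andP[h1 hb] hn0.
have ha : normc h * (K + 1) <= a by rewrite -ler_pdivlMr ?ltr_wpDl // ltW.
pose x := z ord0; pose y j := x j + h * (j == i)%:R.
have yE : (h *: delta_mx ord0 i + z) ord0 = y.
  by apply/funext => j; rewrite !mxE eqxx addrC.
have xy : close_by (normc h) x y.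
  move=> j; rewrite /y addrC addKr; case: eqP => _; first by rewrite mulr1.
  by rewrite mulr0 Normc.normc0 normc_ge0.
have xr : in_box r x.
  by apply: in_box_close => j; rewrite subrr Normc.normc0.
have yr : in_box r y.
  by apply: in_box_close => j; exact: le_trans (xy j) (ltW h1).
have := hK x y _ xr yr xy.
have -> : dpoly f x y = h * (f^`M(i)).@[x].
  rewrite /dpoly (bigD1 i) //= big1 => [|j ji]; last first.
    by rewrite /y (negbTE ji) mulr0 addr0 subrr mul0r.
  by rewrite /y eqxx mulr1 addr0 addrC addKr.
rewrite /= /mpoly_fun yE -/x distrC normr_normc lecR => hh.
have hn : 0 < normc h by rewrite normc_gt0.
rewrite -(ler_pM2l hn) -Normc.normcM mulrBr.
rewrite (_ : h * (h^-1 *: _) = f.@[y] - f.@[x]);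
  last by rewrite /GRing.scale /= mulrA mulfV // mul1r.
apply: le_trans hh _; rewrite expr2 mulrCA ler_pM2l //.
by apply: le_trans ha; rewrite mulrC ler_pM2l // lerDl.
Qed.

Lemma le_eucl_norm (z : 'rV[C]_n) i : normc (z ord0 i) <= eucl_norm z.
Proof.
rewrite -[leLHS](ger0_norm (normc_ge0 _)) -sqrtr_sqr; apply: ler_wsqrtr.
by rewrite (bigD1 i) //= lerDl; apply: sumr_ge0 => j _; exact: sqr_ge0.
Qed.

Lemma eucl_norm_le (z : 'rV[C]_n) e : 0 <= e ->
  (forall i, normc (z ord0 i) <= e) -> eucl_norm z <= n%:R * e.
Proof.
move=> e0 ze; have ne : 0 <= n%:R * e by rewrite mulr_ge0.
rewrite -[leRHS](ger0_norm ne) -sqrtr_sqr; apply: ler_wsqrtr.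
apply: (@le_trans _ _ (n%:R * e ^+ 2)).
  by apply: ler_sum_ord => i; rewrite lerXn2r ?nnegrE ?normc_ge0.
rewrite exprMn ler_wpM2r ?sqr_ge0 // -natrX ler_nat.
by case: n => // k; rewrite leq_pmulr.
Qed.

Lemma eucl_norm_ge0 (z : 'rV[C]_n) : 0 <= eucl_norm z.
Proof. exact: sqrtr_ge0. Qed.

End Topology.

(** * The Lojasiewicz exponent *)

Section Lojasiewicz.
Variables (R : realType) (n : nat) (w : n.-tuple nat) (d : nat).
Variable (f : {mpoly R[i][n]}).
Local Notation C := (R[i]^o).
Local Notation normc := (@Normc.normc R).
Hypothesis w_gt0 : forall i, (0 < tnth w i)%N.
Hypothesis hf : f \is d.-homog for (wdeg w).

Lemma mderiv_scale (s : R) i x :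
  (f^`M(i)).@[fun j => s%:C ^+ tnth w j * x j]
    = s%:C ^+ (d - tnth w i) * (f^`M(i)).@[x].
Proof. exact: dhomog_scale (dhomog_mderiv i hf). Qed.

Lemma scale_small (x : 'I_n -> R[i]) (e : R) : 0 < e ->
  exists2 s0, 0 < s0 <= 1 & forall s, 0 < s <= s0 ->
    forall i, normc (s%:C ^+ tnth w i * x i) < e.
Proof.
move=> e0; pose M := max_normc x + 1.
have M0 : 0 < M by rewrite ltr_wpDl // max_normc_ge0.
exists (Num.min 1 (e / M)); first by rewrite lt_min ltr01 divr_gt0 // ge_min lexx.
move=> s /andP[s0]; rewrite le_min => /andP[s1 se] i.
rewrite Normc.normcM normcX normcR (ger0_norm (ltW s0)).
have sw : s ^+ tnth w i <= s by rewrite ler_iXnr // ltW.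
have xM : normc (x i) < M by apply: le_lt_trans (le_max_normc x i) _; rewrite ltrDl.
apply: (@le_lt_trans _ _ (s * normc (x i))); first by rewrite ler_wpM2r ?normc_ge0.
apply: (@lt_le_trans _ _ (s * M)); first by rewrite ltr_pM2l.
by rewrite -ler_pdivlMr.
Qed.

(** The orbit of a nonzero critical point consists of critical points and
    accumulates at 0. *)
Lemma critical_point_unique : isolated_critical_point (mpoly_fun f) 0 ->
  forall x, (forall i, (f^`M(i)).@[x] = 0) -> forall i, x i = 0.
Proof.
move=> [_]; rewrite /dnbhs near_withinE => /near0_normcP[e e0 he] x fx i; apply/eqP.
apply: contrapT => /negP xi.
have [s0 /andP[s00 _] hs] := scale_small x e0.
pose z : 'rV[C]_n := \row_j (s0%:C ^+ tnth w j * x j).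
have zE : z ord0 = fun j => s0%:C ^+ tnth w j * x j by apply/funext => j; rewrite mxE.
have ze j : normc (z ord0 j) < e by rewrite zE; apply: hs; rewrite s00 lexx.
have := he z ze; rewrite grad_mpolyE zE => /(_ _)/negP; apply.
  apply/eqP => z0; have := congr1 (fun u : 'rV[C]_n => u ord0 i) z0.
  rewrite !mxE => /eqP; rewrite mulf_eq0 (negbTE xi) orbF expf_eq0.
  by rewrite (gt_eqF (_ : 0 < s0%:C)) ?andbF // ltcR.
by apply/eqP/rowP => j; rewrite !mxE mderiv_scale fx mulr0.
Qed.

Variable i0 : 'I_n.
Hypothesis w_min : forall i, (tnth w i0 <= tnth w i)%N.
Hypothesis hd : forall i, (2 * tnth w i <= d)%N.
Hypothesis critical : forall x, (forall i, (f^`M(i)).@[x] = 0) -> forall i, x i = 0.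

Let lambda0 : R := d%:R / (tnth w i0)%:R - 1.

Let w0R : 0 < (tnth w i0)%:R :> R.
Proof. by rewrite ltr0n. Qed.

Let lambda0E : (tnth w i0)%:R * lambda0 = (d - tnth w i0)%:R.
Proof.
rewrite /lambda0 mulrBr mulr1 mulrCA mulfV ?mulr1 ?gt_eqF // natrB //.
by have := hd i0; lia.
Qed.

Let lambda0_gt0 : 0 < lambda0.
Proof.
rewrite -(pmulr_rgt0 _ w0R) lambda0E ltr0n.
by have := hd i0; have := w_gt0 i0; lia.
Qed.

(** For a quasi-norm [t <= 1] one has [eucl_norm z <= n * t ^ w_0], and
    [w_0 * lambda0 = d - w_0]. *)
Lemma lojasiewicz_admissible : exists2 c : R, 0 < c &
  \forall z \near (0 : 'rV[C]_n),
    c * eucl_norm z `^ lambda0 <= eucl_norm (grad (mpoly_fun f) z).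
Proof.
have [c c0 hc] := quasi_norm_ge hf critical.
have n0 : 0 < n%:R :> R by rewrite ltr0n (leq_ltn_trans _ (ltn_ord i0)).
exists (c / n%:R `^ lambda0); first by rewrite divr_gt0 // powR_gt0.
apply/near0_normcP; exists 1 => // z z1.
have [/existsP zn0|] := boolP [exists i, z ord0 i != 0]; last first.
  rewrite negb_exists => /forallP z0.
  rewrite (_ : eucl_norm z = 0) ?powR0 ?gt_eqF // ?mulr0 ?eucl_norm_ge0 //.
  apply/eqP; rewrite eq_le eucl_norm_ge0 andbT -[leRHS](mulr0 n%:R).
  apply: eucl_norm_le => // i; move: (z0 i); rewrite negbK => /eqP ->.
  by rewrite Normc.normc0.
have [t t0 [zt [k zk]]] := quasi_norm_exists w_gt0 zn0.
have t1 : t <= 1.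
  rewrite leNgt; apply/negP => t1; have := z1 k; rewrite zk ltNge => /negP; apply.
  by rewrite exprn_ege1 // ltW.
have [l hl] := hc t _ t0 zt (ex_intro _ k zk).
have h1 : c * t ^+ (d - tnth w i0) <= eucl_norm (grad (mpoly_fun f) z).
  apply: le_trans (le_eucl_norm _ l); rewrite grad_mpolyE mxE.
  apply: le_trans hl; rewrite ler_pM2l //.
  by apply: ler_wiXn2l; rewrite ?leq_sub2l // ltW.
apply: le_trans h1; rewrite -mulrA ler_pM2l // mulrC ler_pdivrMr ?powR_gt0 //.
have h2 : eucl_norm z <= n%:R * t ^+ tnth w i0.
  apply: eucl_norm_le => [|i]; first by rewrite exprn_ge0 // ltW.
  by apply: le_trans (zt i) _; apply: ler_wiXn2l => //; exact: ltW.
apply: (@le_trans _ _ ((n%:R * t ^+ tnth w i0) `^ lambda0)).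
  by rewrite ge0_ler_powR ?nnegrE ?eucl_norm_ge0 ?mulr_ge0 ?exprn_ge0 // ltW.
have tl : (t ^+ tnth w i0) `^ lambda0 = t ^+ (d - tnth w i0).
  by rewrite -powR_mulrn ?ltW // -powRrM lambda0E powR_mulrn ?ltW.
have t_ge0 := ltW t0.
by rewrite powRM ?ler0n ?exprn_ge0 // tl mulrC.
Qed.

(** On the orbit of the polar point [x] the inequality implies
    [c <= N * M * s `^ (w_0 * (lambda0 - lambda))], which fails for small [s] if
    the exponent is positive. *)
Lemma lojasiewicz_lower_bound (lambda c : R) : 0 < lambda -> 0 < c ->
  (\forall z \near (0 : 'rV[C]_n),
    c * eucl_norm z `^ lambda <= eucl_norm (grad (mpoly_fun f) z)) ->
  lambda0 <= lambda.
Proof.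
move=> l0 c0 /near0_normcP[e e0 he].
have [x x0 hx] := polar_point_exists w_gt0 hd w_min hf critical.
rewrite leNgt; apply/negP => ll.
have [s0 /andP[s00 s01] hs] := scale_small x e0.
pose M := max_normc (fun i => (f^`M(i)).@[x]); have M0 : 0 <= M := max_normc_ge0 _.
pose N := n%:R : R; have N0 : 0 <= N by rewrite ler0n.
pose W := (tnth w i0)%:R : R.
pose g := W * (lambda0 - lambda).
have g0 : 0 < g by rewrite mulr_gt0 // subr_gt0.
have key s : 0 < s <= s0 -> c <= N * M * s `^ g.
  move=> /[dup] ss0 /andP[sp sle].
  have s1 : s <= 1 := le_trans sle s01.
  pose z : 'rV[C]_n := \row_j (s%:C ^+ tnth w j * x j).
  have zE : z ord0 = fun j => s%:C ^+ tnth w j * x j by apply/funext => j; rewrite mxE.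
  have ze j : normc (z ord0 j) < e by rewrite zE; exact: hs.
  have h1 := he z ze.
  have h2 : s ^+ tnth w i0 <= eucl_norm z.
    apply: le_trans (le_eucl_norm z i0).
    by rewrite zE x0 mulr1 normcX normcR ger0_norm // ltW.
  have h3 : eucl_norm (grad (mpoly_fun f) z) <= N * (M * s ^+ (d - tnth w i0)).
    apply: eucl_norm_le => [|i]; first by rewrite mulr_ge0 // exprn_ge0 // ltW.
    rewrite grad_mpolyE mxE zE mderiv_scale mulrC.
    have [wi|wi] := ltnP (tnth w i0) (tnth w i).
      by rewrite hx // mul0r Normc.normc0 mulr_ge0 // exprn_ge0 // ltW.
    rewrite (_ : tnth w i = tnth w i0); last by apply/eqP; rewrite eqn_leq wi w_min.
    apply: normcM_le; first exact: (le_max_normc (fun i => (f^`M(i)).@[x]) i).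
    by rewrite normcX normcR ger0_norm // ltW.
  have h4 : s `^ (W * lambda) <= eucl_norm z `^ lambda.
    rewrite powRrM (powR_mulrn _ (ltW sp)).
    apply: ge0_ler_powR => //; rewrite ?nnegrE ?eucl_norm_ge0 //; first exact: ltW.
    by rewrite exprn_ge0 // ltW.
  have h5 : c * s `^ (W * lambda) <= N * (M * s ^+ (d - tnth w i0)).
    by apply: le_trans h3; apply: le_trans h1; rewrite ler_pM2l.
  have h6 : s ^+ (d - tnth w i0) = s `^ g * s `^ (W * lambda).
    rewrite -(powR_mulrn _ (ltW sp)) -lambda0E -powRD; last first.
      by rewrite (gt_eqF sp) implybT.
    by rewrite /g (mulrBr W lambda0) subrK.
  have h7 : c * s `^ (W * lambda) <= N * M * s `^ g * s `^ (W * lambda).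
    by rewrite -!mulrA -h6.
  by move: h7; rewrite ler_pM2r // powR_gt0.
pose D := 2 * (N * M + 1) : R.
have D0 : 0 < D by rewrite mulr_gt0 // ltr_wpDl // mulr_ge0.
pose s := Num.min s0 ((c / D) `^ g^-1).
have sp : 0 < s by rewrite lt_min s00 powR_gt0 // divr_gt0.
have sg : s `^ g <= c / D.
  have : s `^ g <= ((c / D) `^ g^-1) `^ g.
    rewrite ge0_ler_powR ?nnegrE ?powR_ge0 ?(ltW g0) ?(ltW sp) //.
    by rewrite ge_min lexx orbT.
  by rewrite -powRrM mulVf ?gt_eqF // powRr1 // ltW // divr_gt0.
have := key s; rewrite sp ge_min lexx => /(_ isT).
have : s `^ g * D <= c by rewrite -ler_pdivlMr.
have := powR_ge0 s g; rewrite /D; move: c0; set u := s `^ g.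
have NM : 0 <= N * M by rewrite mulr_ge0.
by nra.
Qed.

End Lojasiewicz.

Theorem theorem3 (R : realType) (n : nat) (hn : (0 < n)%N)
  (w : n.-tuple nat) (hw : forall i : 'I_n, (0 < tnth w i)%N)
  (d : nat) (hd0 : (0 < d)%N) (hd : forall i : 'I_n, (2 * tnth w i <= d)%N)
  (f : {mpoly R[i][n]})
  (hf0 : mpoly_fun f 0 = 0)
  (hf : f \is d.-homog for (wdeg w))
  (hiso : isolated_critical_point (mpoly_fun f) 0) :
  lojasiewicz_exponent (mpoly_fun f) =
    \big[maxe/-oo%E]_(i < n) (d%:R / (tnth w i)%:R - 1)%:E.
Proof.
have crit := critical_point_unique hw hf hiso.
have [i0 _ imin] := @arg_minnP _ (Ordinal hn) xpredT (fun i => tnth w i) isT.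
have {}imin i : (tnth w i0 <= tnth w i)%N by exact: imin.
have w0R i : 0 < (tnth w i)%:R :> R by rewrite ltr0n.
have -> : \big[maxe/-oo%E]_(i < n) (d%:R / (tnth w i)%:R - 1)%:E =
    (d%:R / (tnth w i0)%:R - 1 : R)%:E.
  apply/eqP; rewrite eq_le; apply/andP; split; last first.
    exact: (le_bigmax -oo%E (fun i => (d%:R / (tnth w i)%:R - 1 : R)%:E) i0).
  apply: bigmax_le => [|i _]; first exact: leNye.
  by rewrite lee_fin lerD2r ler_wpM2l // lef_pV2 ?posrE // ler_nat.
apply/eqP; rewrite eq_le; apply/andP; split.
  apply: ereal_inf_lbound; exists (d%:R / (tnth w i0)%:R - 1) => //; split.
    rewrite subr_gt0 ltr_pdivlMr // mul1r ltr_nat.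
    by have := hd i0; have := hw i0; lia.
  exact: lojasiewicz_admissible.
apply: le_ereal_inf_tmp => _ [lambda [l0 [c c0 hc]] <-].
by rewrite lee_fin; apply: lojasiewicz_lower_bound hc.
Qed.
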